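(* Let $H_1,H_2\in(0,1)$, let $(a,b)\in\mathbb{R}^2\setminus\{(0,0)\}$, and let $N^{H_1H_2}(a,b)=\{N^{H_1H_2}_t(a,b),\ t\ge 0\}$ be the fractional mixed fractional Brownian motion $N^{H_1H_2}_t(a,b)=aB^{H_1}_t+bB^{H_2}_t$, where $B^{H_1}$ and $B^{H_2}$ are independent fractional Brownian motions with Hurst exponents $H_1$ and $H_2$. Let $T^{\alpha}=\{T^{\alpha}_t,\ t\ge 0\}$ be an inverse $\alpha$-stable subordinator with index $\alpha\in(0,1)$, independent of $(B^{H_1},B^{H_2})$. If $H_1<H_2$ and $0<2\alpha H_1-\alpha H_2<1$, then the time-changed process $L^{H_1H_2}_{T^{\alpha}}(a,b)=\{L^{H_1H_2}_{T^\alpha_t},\ t\ge 0\}$ defined by $$L^{H_1H_2}_{T^{\alpha}_t}=N^{H_1H_2}_{T^{\alpha}_t}(a,b)=aB^{H_1}_{T^{\alpha}_t}+bB^{H_2}_{T^{\alpha}_t},\qquad t\ge 0,$$ has the long range dependence property.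
   Context: A fractional Brownian motion $B^H=\{B^H_t,\ t\ge 0\}$ with Hurst exponent $H\in(0,1)$ is the centered Gaussian process with continuous paths, $B^H_0=0$, and covariance $E(B^H_tB^H_s)=\frac12\left(t^{2H}+s^{2H}-|t-s|^{2H}\right)$. The inverse $\alpha$-stable subordinator with index $\alpha\in(0,1)$ is defined by $T^{\alpha}_t=\inf\{r>0:\ \eta^{\alpha}_r\ge t\}$, where $\eta^{\alpha}=\{\eta^{\alpha}_r,\ r\ge 0\}$ is the $\alpha$-stable subordinator, i.e. the non-decreasing Lévy process started at $0$ with Laplace transform $E(e^{-u\eta^{\alpha}_r})=e^{-ru^{\alpha}}$ for $u\ge 0$. For centered square-integrable random variables $U,V$ on the same probability space, $\mathrm{Corr}(U,V)=\dfrac{\mathrm{Cov}(U,V)}{\sqrt{E(U^2)E(V^2)}}$. Long range dependence (for a not necessarily stationary process): a process $\{X_t,\ t\ge 0\}$ has the long range dependence property if there is $d\in(0,1)$ such that for each fixed $s>0$, $\mathrm{Corr}(X_t,X_s)\sim c(s)\,t^{-d}$ as $t\to\infty$, where $c(s)$ is a constant depending on $s$. Here $f(t)\sim g(t)$ means $f(t)/g(t)\to 1$ (so $c(s)\ne 0$). *)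

(* Defs.v *)
From HB Require Import structures.
From mathcomp Require Import all_boot all_order all_algebra.
From mathcomp Require Import all_classical all_reals all_analysis.

Set Implicit Arguments.
Unset Strict Implicit.
Unset Printing Implicit Defensive.

Import Order.TTheory GRing.Theory Num.Theory.
Import numFieldNormedType.Exports.

Local Open Scope classical_set_scope.
Local Open Scope ring_scope.

(* A real process {X_t, t >= 0} is a function X : R -> Omega -> R, constrained
   and observed only at times t >= 0; its values at t < 0 play no role. *)

Section processes.
Context (d : measure_display) (Omega : measurableType d) (R : realType).
Variable P : probability Omega R.
Implicit Types (X Y : R -> Omega -> R) (U V : Omega -> R).

Definition process_events X : set (set Omega) :=
  [set A | exists t : R, exists B : set R,
     [/\ 0 <= t, measurable B & A = X t @^-1` B]].

Definition independent_sigma (F G : set (set Omega)) : Prop :=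
  forall A B, <<s F >> A -> <<s G >> B -> P (A `&` B) = (P A * P B)%E.

Definition independent_processes X Y : Prop :=
  independent_sigma (process_events X) (process_events Y).

Definition independent_of_pair X Y1 Y2 : Prop :=
  independent_sigma (process_events X)
    (process_events Y1 `|` process_events Y2).

(* Degenerate laws are included. They are given by dirac because
   normal_prob m 0 is by convention the uniform law on [0, 1]. *)
Definition gaussian_law U : Prop :=
  exists m s : R,
    (s != 0 /\ forall A, measurable A -> P (U @^-1` A) = normal_prob m s A) \/
    (forall A, measurable A -> P (U @^-1` A) = dirac m A).

Record gaussian_process X : Prop := {
  gaussian_process_measurable :
    forall t : R, 0 <= t -> measurable_fun setT (X t);
  gaussian_process_combination :
    forall (n : nat) (c t : 'I_n -> R), (forall i, 0 <= t i) ->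
      gaussian_law (fun w => \sum_(i < n) c i * X (t i) w) }.

Record fractional_brownian_motion (H : R) X : Prop := {
  fbm_gaussian : gaussian_process X;
  fbm_centered : forall t : R, 0 <= t -> 'E_P[X t]%E = 0%E;
  fbm_continuous :
    forall w, {within `[0, +oo[, continuous (fun t => X t w)};
  fbm_start : forall w, X 0 w = 0;
  fbm_covariance : forall t s : R, 0 <= t -> 0 <= s ->
    'E_P[(fun w => X t w * X s w)%R]%E =
      ((t `^ (2 * H) + s `^ (2 * H) - `|t - s| `^ (2 * H)) / 2)%:E }.

Record levy_process X : Prop := {
  levy_measurable : forall t : R, 0 <= t -> measurable_fun setT (X t);
  levy_start : forall w, X 0 w = 0;
  levy_independent_increments :
    forall (n : nat) (t : nat -> R) (A : nat -> set R),
      0 <= t 0%N -> {homo t : i j / (i <= j)%N >-> i <= j} ->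
      (forall i, measurable (A i)) ->
      P (\bigcap_(i in `I_n) ((X (t i.+1) \- X (t i)) @^-1` A i)) =
      (\prod_(i < n) P ((X (t i.+1) \- X (t i))%R @^-1` A i))%E;
  levy_stationary_increments :
    forall s t : R, 0 <= s -> s <= t -> forall A : set R, measurable A ->
      P ((X t \- X s) @^-1` A) = P (X (t - s) @^-1` A);
  levy_right_continuous :
    forall w (t : R), 0 <= t -> X r w @[r --> t^'+] --> X t w;
  levy_left_limit :
    forall w (t : R), 0 < t -> cvg (X r w @[r --> t^'-]) }.

Record stable_subordinator (alpha : R) X : Prop := {
  subordinator_levy : levy_process X;
  subordinator_nondecreasing :
    forall w (r1 r2 : R), 0 <= r1 -> r1 <= r2 -> X r1 w <= X r2 w;
  subordinator_laplace : forall r u : R, 0 <= r -> 0 <= u ->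
    'E_P[(fun w => expR (- (u * X r w)))%R]%E = (expR (- (r * u `^ alpha)))%:E }.

(* The infimum is real-valued, with inf set0 = 0; for a stable subordinator
   the set below is nonempty for all t outside a P-null event. *)
Definition first_passage_time X : R -> Omega -> R :=
  fun t w => inf [set r | 0 < r /\ t <= X r w].

Definition inverse_stable_subordinator (alpha : R) X : Prop :=
  exists2 eta, stable_subordinator alpha eta &
    forall t : R, 0 <= t -> X t = first_passage_time eta t.

Definition time_change X Y : R -> Omega -> R := fun t w => X (Y t w) w.

Definition mixed_process (a b : R) X Y : R -> Omega -> R :=
  fun t w => a * X t w + b * Y t w.

Definition centered_square_integrable U : Prop :=
  U \in Lfun P 2%:E /\ 'E_P[U]%E = 0%E.

Definition Corr U V : R :=
  fine (covariance P U V) /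
  Num.sqrt (fine 'E_P[(fun w => U w ^+ 2)%R]%E * fine 'E_P[(fun w => V w ^+ 2)%R]%E).

(* f(t) ~ g(t) as t --> +oo, in the quotient form *)
Definition equivalent_at_infinity (f g : R -> R) : Prop :=
  f t / g t @[t --> +oo] --> (1 : R).

(* Corr is defined for centered square-integrable variables only; the first
   clause keeps it from being evaluated at junk values. *)
Definition long_range_dependence X : Prop :=
  (forall t : R, 0 <= t -> centered_square_integrable (X t)) /\
  exists2 delta : R, 0 < delta < 1 &
    forall s : R, 0 < s -> exists2 c : R, c != 0 &
      equivalent_at_infinity
        (fun t => Corr (X t) (X s)) (fun t => c * t `^ (- delta)).

End processes.

(* Main.v *)
Require Import Defs.
From HB Require Import structures.
From mathcomp Require Import all_boot all_order all_algebra.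
From mathcomp Require Import all_classical all_reals all_analysis.
From mathcomp Require Import measurable_realfun ring lra.

Set Implicit Arguments.
Unset Strict Implicit.
Unset Printing Implicit Defensive.

Import Order.TTheory GRing.Theory Num.Theory.
Import numFieldNormedType.Exports.

Local Open Scope classical_set_scope.
Local Open Scope ring_scope.

(** Conditionally on the inverse subordinator [T], the time-changed process is
    Gaussian with the covariances of the two fractional Brownian motions read
    at the random times, so
    E(L_t - L_s)^2 = a^2 E|T_t - T_s|^(2 H1) + b^2 E|T_t - T_s|^(2 H2).
    Polarization, with L_0 = 0, turns this into an exact formula for the
    covariance, and everything reduces to moments of [T] and of its increments
    ([time_change_increment_integral], [time_change_covariance]).

    The moments of [T] are pure powers: P(T_t > r) = P(eta_r < t), and the
    Laplace transform of the stable subordinator, which determines its law,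
    makes t^-1 eta_(x t^alpha) a copy of eta_x. Hence
    E T_t^q = t^(alpha q) E T_1^q.

    For theta = 2 H and fixed s, the contribution of one component to the
    covariance is half of E T_s^theta + E(T_t^theta - (T_t - T_s)^theta).
    If theta < 1 the last expectation tends to 0, because T_t escapes to
    infinity and x^theta is concave; if theta = 1 it equals E T_s; if
    theta > 1 the tangent inequality gives theta E(T_s T_t^(theta - 1)) up to a
    bounded error. In this product the two factors decouple asymptotically: on
    the event T_s > r, the increments of eta after time r are independent
    of the past, so that T_t - r is, up to a shift of t by at most s, an
    independent copy of T_t. The covariance thus grows like
    t^max(0, alpha (theta - 1)) with a positive constant
    ([fpt_covariance_asymptotics]).

    Both this exponent and the exponent alpha theta of the variance increase
    with H, so that the component with the larger Hurst index among those
    with a nonzero coefficient dominates. For its index H the correlation decays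
    like t^-d with d = alpha H - max(0, alpha (2 H - 1)), that is
    d = alpha H if H <= 1/2 and d = alpha (1 - H) otherwise; both lie
    in ]0, 1[. *)

(** * Layer-cake formula and comparison of expectations through tails *)

Section layer_cake.
Context (d : measure_display) (T : measurableType d) (R : realType).
Variable P : probability T R.
Local Notation mu := (@lebesgue_measure R).
Local Notation GR := (measurableTypeR R).

Lemma measurable_gt_set (X : T -> R) (r : R) :
  measurable_fun setT X -> measurable [set w | r < X w].
Proof.
move=> mX.
rewrite (_ : [set w | _] = X @^-1` `]r, +oo[).
  by rewrite -[X in measurable X]setTI; exact: mX.
by apply/seteqP; split=> w /=; rewrite in_itv/= andbT.
Qed.

Lemma measurable_ge_set (X : T -> R) (r : R) :
  measurable_fun setT X -> measurable [set w | r <= X w].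
Proof.
move=> mX.
rewrite (_ : [set w | _] = X @^-1` `[r, +oo[).
  by rewrite -[X in measurable X]setTI; exact: mX.
by apply/seteqP; split=> w /=; rewrite in_itv/= andbT.
Qed.

Section layer.
Variables X Y : T -> R.
Hypothesis mX : measurable_fun setT X.
Hypothesis mY : measurable_fun setT Y.
Hypothesis X0 : forall w, 0 <= X w.
Hypothesis Y0 : forall w, 0 <= Y w.

Let g (p : T * GR) : R := Y p.1 * \1_[set q : T * GR | 0 <= q.2 < X q.1] p.

Let mg : measurable_fun setT (EFin \o g).
Proof.
apply/measurable_EFinP; apply: measurable_funM.
  exact: measurableT_comp mY measurable_fst.
apply: measurable_indic.
have mA : measurable_fun setT (fun p : T * GR => (0 <= p.2)%R).
  exact: measurable_fun_ler.
have mB : measurable_fun setT (fun p : T * GR => (p.2 < X p.1)%R).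
  apply: measurable_fun_ltr; first exact: measurable_snd.
  exact: measurableT_comp mX measurable_fst.
have := measurableI _ _ (mA measurableT [set true] I) (mB measurableT [set true] I).
rewrite !setTI; congr (measurable _).
by apply/seteqP; split => p /=; [move=> [-> ->]|move/andP].
Qed.

Let gE w r : g (w, r) = Y w * \1_(`[0, X w[%classic : set R) r.
Proof.
rewrite /g !indicE /= (_ : (_ \in _) = (r \in (`[0, X w[%classic : set R)))//.
Qed.

Let g_ge0 p : (0 <= (EFin \o g) p)%E.
Proof. by rewrite lee_fin mulr_ge0. Qed.

Let gr (r : R) : 0 <= r ->
  'E_P[Y \* \1_[set w | (r < X w)%R]]%E = (\int[P]_w (g (w, r))%:E)%E.
Proof.
move=> r0; rewrite unlock; apply: eq_integral => w _.
rewrite gE/= !indicE; congr (_ * (nat_of_bool _)%:R)%:E.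
by apply: asbool_equiv_eq; rewrite /= in_itv/= r0.
Qed.

(** Tonelli for X w = \int_0^oo 1_(r < X w) dr. The weight [Y] makes the same
    formula serve for products of dependent variables. *)
Lemma layer_cake : 'E_P[X \* Y]%E =
  (\int[mu]_(r in `[0%R, +oo[) 'E_P[Y \* \1_[set w | (r < X w)%R]])%E.
Proof.
transitivity (\int[P]_w \int[mu]_r (g (w, r))%:E)%E.
  rewrite unlock; apply: eq_integral => w _.
  under eq_integral do rewrite gE EFinM.
  rewrite ge0_integralZl//=; first last.
  - by rewrite lee_fin.
  - apply/measurable_EFinP; apply: measurable_indic; exact: measurable_itv.
  rewrite integral_indic//.
  rewrite setIT -[X in _ = (_ * X)%E]/(mu (`[0%R, X w[%classic : set R)).
  rewrite lebesgue_measure_itv/= lte_fin.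
  have := X0 w; rewrite le_eqVlt => /predU1P[<-|Xw].
    by rewrite ltxx mul0r mule0.
  by rewrite Xw sube0 -EFinM mulrC.
rewrite (@fubini_tonelli _ _ _ _ _ P mu (EFin \o g))//=.
rewrite [RHS]integral_mkcond; apply: eq_integral => r _.
rewrite patchE; case: ifPn => r0; last first.
  rewrite integral0_eq// => w _; rewrite gE indicE memNset ?mulr0//=.
  rewrite in_itv/= => /andP[r0' _]; move/negP: r0; apply.
  by rewrite inE/= in_itv/= r0'.
by move: r0; rewrite inE/= in_itv/= andbT => r0; rewrite -gr.
Qed.

Lemma measurable_layer : measurable_fun (`[0%R, +oo[%classic : set R)
  (fun r => 'E_P[Y \* \1_[set w | (r < X w)%R]]%E).
Proof.
apply: (eq_measurable_fun (fun r => \int[P]_w (g (w, r))%:E)%E).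
  by move=> r /set_mem/=; rewrite in_itv/= andbT => r0; rewrite gr.
apply: measurable_funTS.
exact: (@measurable_fun_fubini_tonelli_G _ _ _ _ _ P (EFin \o g)).
Qed.

End layer.

(** With [X = X'] it compares weighted expectations through the events
    r < X only; with constant weights it compares expectations through tails. *)
Lemma layer_cake_le (X Y X' Y' : T -> R) :
  measurable_fun setT X -> measurable_fun setT Y ->
  (forall w, 0 <= X w) -> (forall w, 0 <= Y w) ->
  measurable_fun setT X' -> measurable_fun setT Y' ->
  (forall w, 0 <= X' w) -> (forall w, 0 <= Y' w) ->
  (forall r, 0 <= r -> ('E_P[Y \* \1_[set w | (r < X w)%R]] <=
     'E_P[Y' \* \1_[set w | (r < X' w)%R]])%E) ->
  ('E_P[X \* Y] <= 'E_P[X' \* Y'])%E.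
Proof.
move=> mX mY X0 Y0 mX' mY' X'0 Y'0 h.
rewrite !layer_cake//; apply: ge0_le_integral => //=.
- by move=> r _; apply: expectation_ge0 => w /=; rewrite mulr_ge0.
- exact: measurable_layer.
- exact: measurable_layer.
- by move=> r; rewrite in_itv/= andbT; exact: h.
Qed.

Lemma expectation_scaled_indic (k : R) (A : set T) : measurable A -> 0 <= k ->
  'E_P[cst k \* \1_A]%E = (k%:E * P A)%E.
Proof.
move=> mA k0; rewrite unlock.
rewrite (eq_integral (fun w => k%:E * (\1_A w)%:E)%E)//.
rewrite ge0_integralZl//=; last by apply/measurable_EFinP; exact: measurable_indic.
by rewrite integral_indic// setIT.
Qed.

Lemma expectation_scale (k : R) (X : T -> R) : measurable_fun setT X ->
  (forall w, 0 <= X w) -> 0 <= k ->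
  'E_P[X \* cst k]%E = (k%:E * 'E_P[X])%E.
Proof.
move=> mX X0 k0; rewrite unlock.
under eq_integral do rewrite /= mulrC EFinM.
rewrite ge0_integralZl//=; first exact/measurable_EFinP.
by move=> x _; rewrite lee_fin.
Qed.

Lemma tail_le (k l : R) (X Y : T -> R) :
  measurable_fun setT X -> (forall w, 0 <= X w) ->
  measurable_fun setT Y -> (forall w, 0 <= Y w) -> 0 <= k -> 0 <= l ->
  (forall r, 0 <= r -> (k%:E * P [set w | (r < X w)%R] <=
                        l%:E * P [set w | (r < Y w)%R])%E) ->
  (k%:E * 'E_P[X] <= l%:E * 'E_P[Y])%E.
Proof.
move=> mX X0 mY Y0 k0 l0 h; rewrite -!expectation_scale//.
apply: layer_cake_le => // r r0.
by rewrite !expectation_scaled_indic//; [exact: h|exact: measurable_gt_set..].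
Qed.

Lemma eq_tail (X Y : T -> R) :
  measurable_fun setT X -> (forall w, 0 <= X w) ->
  measurable_fun setT Y -> (forall w, 0 <= Y w) ->
  (forall r, 0 <= r -> P [set w | r < X w] = P [set w | r < Y w]) ->
  'E_P[X]%E = 'E_P[Y]%E.
Proof.
move=> mX X0 mY Y0 h; rewrite -['E_P[X]%E]mul1e -['E_P[Y]%E]mul1e.
by apply/eqP; rewrite eq_le !tail_le//= => r r0; rewrite h.
Qed.

(** The bound 1 / (1 + r^2) is the derivative of the arctangent. *)
Lemma sqr_tail_integrable (X : T -> R) (C : R) :
  measurable_fun setT X -> (forall w, 0 <= X w) ->
  (forall r : R, 0 <= r ->
    (P [set w | (r < X w)%R] <= (C * (1 + r ^+ 2)^-1)%:E)%E) ->
  ('E_P[X] < +oo)%E.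
Proof.
move=> mX X0 h.
have C0 : 0 <= C.
  have := le_trans (measure_ge0 P _) (h 0 (lexx 0)).
  by rewrite lee_fin expr0n/= addr0 invr1 mulr1.
have -> : 'E_P[X]%E = 'E_P[X \* cst 1%R]%E by rewrite expectation_scale// mul1e.
rewrite layer_cake//.
apply: (@le_lt_trans _ _ (\int[mu]_(r in `[0%R, +oo[) (C%:E * (oneDsqr r)^-1%:E))%E).
  apply: ge0_le_integral => //=.
  - by move=> r _; apply: expectation_ge0 => w /=; rewrite mulr_ge0.
  - exact: measurable_layer.
  - apply/measurable_EFinP; apply: measurable_funTS; apply: measurable_funM => //.
    by apply: continuous_measurable_fun; exact: continuous_oneDsqrV.
  - move=> r; rewrite in_itv/= andbT => r0.
    rewrite expectation_scaled_indic//; last exact: measurable_gt_set.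
    by rewrite mul1e -EFinM; exact: h.
rewrite ge0_integralZl//=; first by rewrite integral0y_oneDsqr -EFinM ltry.
apply/measurable_EFinP; apply: measurable_funTS.
by apply: continuous_measurable_fun; exact: continuous_oneDsqrV.
Qed.

End layer_cake.

(** * Uniqueness of the Laplace transform on the half-line *)

Section laplace_uniqueness.
Context (d : measure_display) (T : measurableType d) (R : realType).
Variable P : probability T R.

Lemma bounded_Lfun1 (f : T -> R) (M : R) :
  measurable_fun setT f -> (forall w, `|f w| <= M) -> f \in Lfun P 1.
Proof.
move=> mf fM; apply/Lfun1_integrable.
apply: measurable_bounded_integrable => //.
  by rewrite (le_lt_trans (probability_le1 P measurableT)) ?ltry.
exists M; split; first exact: num_real.
by move=> x Mx w _; exact: le_trans (fM w) (ltW Mx).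
Qed.

(** The values of these functions under the expectation are combinations of
    values of the Laplace transform; for [v = 0] and suitable large [w] and [N] they
    approximate the indicator of a half-line. *)
Definition exp_poly (v w : R) (N : nat) (x : R) : R :=
  expR (- (v * x)) * (1 - expR (- (w * x))) ^+ N.

Lemma exp_polyS v w N x :
  exp_poly v w N.+1 x = exp_poly v w N x - exp_poly (v + w) w N x.
Proof. by rewrite /exp_poly mulrDl opprD expRD exprS; ring. Qed.

Lemma measurable_exp_poly v w N (U : T -> R) : measurable_fun setT U ->
  measurable_fun setT (exp_poly v w N \o U).
Proof.
move=> mU; have mE z : measurable_fun setT (fun t => expR (- (z * U t))).
  apply: measurableT_comp; first exact: measurable_expR.
  by apply: measurableT_comp => //; exact: measurable_funM.
apply: (@measurable_funM _ _ _ _ (fun t => expR (- (v * U t)))) => //.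
by apply: measurable_funX; exact: measurable_funB.
Qed.

Lemma exp_poly_itv v w N x : 0 <= v -> 0 <= w -> 0 <= x ->
  0 <= exp_poly v w N x <= 1.
Proof.
move=> v0 w0 x0; have e1 z : 0 <= z -> expR (- (z * x)) <= 1.
  by move=> z0; rewrite -expR0 ler_expR oppr_le0 mulr_ge0.
have e2 : 0 <= 1 - expR (- (w * x)) <= 1.
  by rewrite subr_ge0 e1//= lerBlDr lerDl expR_ge0.
case/andP : e2 => e2 e3; apply/andP; split.
  by rewrite mulr_ge0 ?expR_ge0 ?exprn_ge0.
rewrite mulr_ile1 ?expR_ge0 ?exprn_ge0 ?e1//; exact: exprn_ile1.
Qed.

Lemma bernoulli_le (y : R) n : 0 <= y <= 1 -> 1 - n%:R * y <= (1 - y) ^+ n.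
Proof.
move=> /andP[y0 y1]; elim: n => [|n IH]; first by rewrite mul0r subr0 expr0.
rewrite exprSr; have h : 0 <= 1 - y by rewrite subr_ge0.
apply: (le_trans _ (ler_wpM2r h IH)).
have : 0 <= n%:R * y * y :> R by rewrite !mulr_ge0.
rewrite -[n.+1%:R]natr1; lra.
Qed.

Lemma expn_le_inv (y : R) n : 0 < y <= 1 -> (1 - y) ^+ n <= (1 + n%:R * y)^-1.
Proof.
move=> /andP[y0 y1].
have h : (1 - y) ^+ n <= expR (- (n%:R * y)).
  rewrite -mulrN expRM_natl; apply: lerXn2r; rewrite ?nnegrE ?subr_ge0 ?expR_ge0//.
  exact: expR_ge1Dx.
apply: (le_trans h); rewrite expRN lef_pV2 ?posrE ?expR_gt0//.
  exact: expR_ge1Dx.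
by rewrite ltr_pwDl// mulr_ge0// ltW.
Qed.

Variables U V : T -> R.
Hypothesis mU : measurable_fun setT U.
Hypothesis mV : measurable_fun setT V.
Hypothesis U0 : forall w, 0 <= U w.
Hypothesis V0 : forall w, 0 <= V w.
Hypothesis UV : forall u : R, 0 <= u ->
  'E_P[(fun w => expR (- (u * U w)))%R]%E = 'E_P[(fun w => expR (- (u * V w)))%R]%E.

Lemma exp_poly_Lfun1 v w N (X : T -> R) : measurable_fun setT X ->
  (forall w, 0 <= X w) -> 0 <= v -> 0 <= w -> exp_poly v w N \o X \in Lfun P 1.
Proof.
move=> mX X0 v0 w0; apply: (@bounded_Lfun1 _ 1); first exact: measurable_exp_poly.
by move=> x /=; have /andP[? ?] := exp_poly_itv N v0 w0 (X0 x); rewrite ger0_norm.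
Qed.

(** By [exp_polyS], raising [N] by one only needs the statement at two
    values of [v], so induction reduces it to the Laplace
    transform itself. *)
Lemma expectation_exp_poly v w N : 0 <= v -> 0 <= w ->
  'E_P[exp_poly v w N \o U]%E = 'E_P[exp_poly v w N \o V]%E.
Proof.
move=> + w0; elim: N v => [|N IH] v v0.
  have E X : exp_poly v w 0 \o X = (fun x : T => expR (- (v * X x))).
    by apply/funext => x; rewrite /exp_poly/= expr0 mulr1.
  by rewrite !E UV.
have E X : exp_poly v w N.+1 \o X =
    (exp_poly v w N \o X) \- (exp_poly (v + w) w N \o X) :> (T -> R).
  by apply/funext => x; rewrite /= exp_polyS.
have vw0 : 0 <= v + w by exact: addr_ge0.
rewrite (E U) (E V) expectationB; [|exact: exp_poly_Lfun1..].
by rewrite expectationB; [rewrite (IH v v0) (IH (v + w) vw0)|exact: exp_poly_Lfun1..].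
Qed.

(** The polynomials (1 - y^n)^(2^n) tend to 1 on [0, 1/2[ and to 0 on
    ]1/2, 1]. Composed with y = exp (- u x), where u = ln 2 / m, they
    approximate the indicator of x > m for any m between [c0] and [c], and
    their expectations are the same for [U] and [V]. *)
Lemma laplace_tail_le (c0 c : R) : 0 < c0 -> c0 < c ->
  (P [set w | (c <= V w)%R] <= P [set w | (c0 <= U w)%R])%E.
Proof.
move=> c00 c0c.
have mA := measurable_ge_set c mV; have mB := measurable_ge_set c0 mU.
set A := [set w | _] in mA *; set B := [set w | _] in mB *.
pose m := (c0 + c) / 2.
have m0 : 0 < m by rewrite /m; lra.
have c0m : c0 < m by rewrite /m; lra.
have mc : m < c by rewrite /m; lra.
pose u := ln 2 / m.
have u0 : 0 < u by rewrite divr_gt0// ln_gt0// ltr1n.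
have um : u * m = ln 2 by rewrite /u divfK// gt_eqF.
(* geometric rates of convergence of q n beyond c and below c0 *)
pose k1 := expR (- (u * (c - m))); pose k0 := expR (- (u * (m - c0))).
have k1_itv : 0 < k1 < 1.
  by rewrite expR_gt0 -expR0 ltr_expR oppr_lt0 mulr_gt0// subr_gt0.
have k0_itv : 0 < k0 < 1.
  by rewrite expR_gt0 -expR0 ltr_expR oppr_lt0 mulr_gt0// subr_gt0.
pose q n := exp_poly 0 (n%:R * u) (2 ^ n).
have qE n x : q n x = (1 - expR (- (n%:R * u * x))) ^+ (2 ^ n).
  by rewrite /q /exp_poly mul0r oppr0 expR0 mul1r.
have Ny n x : (2 ^ n)%:R * expR (- (n%:R * u * x)) = expR (n%:R * (u * (m - x))).
  have -> : (2 ^ n)%:R = expR (n%:R * (u * m)) :> R.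
    by rewrite um expRM_natl lnK ?posrE// natrX.
  by rewrite -expRD; congr expR; ring.
have nu n : 0 <= n%:R * u by rewrite mulr_ge0// ltW.
have yitv n x : 0 <= x -> 0 < expR (- (n%:R * u * x)) <= 1.
  by move=> x0; rewrite expR_gt0 -[leRHS]expR0 ler_expR oppr_le0 (mulr_ge0 (nu n)).
have q_ge n x : c <= x -> 1 - k1 ^+ n <= q n x.
  move=> cx; have x0 : 0 <= x by rewrite (le_trans _ cx)// ltW// (lt_trans m0).
  rewrite qE; apply: le_trans (bernoulli_le (2 ^ n) _); last first.
    by case/andP : (yitv n x x0) => /ltW -> ->.
  rewrite Ny lerD2l lerN2 /k1 -expRM_natl ler_expR ler_wpM2l// -mulrN opprB.
  by rewrite ler_wpM2l ?(ltW u0)// lerD2l lerN2.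
have q_le n x : 0 <= x -> x < c0 -> q n x <= k0 ^+ n.
  move=> x0 xc0; rewrite qE.
  apply: (le_trans (expn_le_inv _ (yitv n x x0))).
  rewrite Ny -[leRHS]invrK lef_pV2 ?posrE ?invr_gt0 ?exprn_gt0 ?expR_gt0 ?addr_gt0 ?expR_gt0//.
  apply: ler_wpDl => //.
  rewrite /k0 -expRM_natl -expRN ler_expR -mulrN opprK ler_wpM2l//.
  by rewrite ler_wpM2l ?(ltW u0)// lerD2l lerN2 ltW.
have key n : (1 - k1 ^+ n) * fine (P A) <= fine (P B) + k0 ^+ n.
  have k1n : 0 <= 1 - k1 ^+ n.
    by rewrite subr_ge0 exprn_ile1//; case/andP: k1_itv => /ltW ? /ltW.
  have k0n : 0 <= k0 ^+ n by rewrite exprn_ge0// ltW//; case/andP: k0_itv.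
  rewrite -lee_fin EFinM fineK ?fin_num_measure//.
  rewrite -expectation_scaled_indic//.
  apply: (@le_trans _ _ 'E_P[q n \o V]%E).
    apply: expectation_le.
    - by apply: measurable_funM => //; exact: measurable_indic.
    - exact: measurable_exp_poly.
    - by move=> w; rewrite /= mulr_ge0.
    - by move=> w /=; case/andP : (exp_poly_itv (2 ^ n) (lexx 0) (nu n) (V0 w)).
    apply: aeW => w /=; rewrite indicE; case: (boolP (w \in A)) => wA.
      by rewrite mulr1; apply: q_ge; move/set_mem: wA.
    rewrite mulr0.
    by case/andP : (exp_poly_itv (2 ^ n) (lexx 0) (nu n) (V0 w)).
  rewrite /q -expectation_exp_poly//.
  rewrite EFinD fineK ?fin_num_measure//.
  have -> : (P B + (k0 ^+ n)%:E = 'E_P[\1_B \+ cst (k0 ^+ n)%R])%E.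
    rewrite expectationD ?expectation_indic ?expectation_cst//.
    + apply: (@bounded_Lfun1 _ 1); first exact: measurable_indic.
      by move=> w; rewrite indicE; case: (_ \in _); rewrite ?normr1 ?normr0.
    + exact: Lfun_cst.
  apply: expectation_le.
  - exact: measurable_exp_poly.
  - by apply: measurable_funD => //; exact: measurable_indic.
  - by move=> w /=; case/andP : (exp_poly_itv (2 ^ n) (lexx 0) (nu n) (U0 w)).
  - by move=> w; rewrite /= addr_ge0.
  apply: aeW => w /=; rewrite indicE; case: (boolP (w \in B)) => wB.
    apply: ler_wpDr => //.
    by case/andP : (exp_poly_itv (2 ^ n) (lexx 0) (nu n) (U0 w)).
  rewrite add0r; apply: q_le => //; rewrite ltNge; apply/negP => h.
  by move/negP: wB; apply; apply/mem_set.
rewrite -(fineK (fin_num_measure P A mA)) -(fineK (fin_num_measure P B mB)) lee_fin.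
have lim k : 0 < k < 1 -> k ^+ n @[n --> \oo] --> (0 : R).
  by move=> /andP[k_0 k_1]; apply: cvg_expr; rewrite gtr0_norm.
have l1 : (1 - k1 ^+ n) * fine (P A) @[n --> \oo] --> (1 - 0) * fine (P A).
  by apply: cvgM; [apply: cvgB; [exact: cvg_cst|exact: lim]|exact: cvg_cst].
have l2 : fine (P B) + k0 ^+ n @[n --> \oo] --> fine (P B) + 0.
  by apply: cvgD; [exact: cvg_cst|exact: lim].
move: l1 l2; rewrite subr0 mul1r addr0 => l1 l2.
by apply: (ler_cvg_to l1 l2); near=> n; exact: key.
Unshelve. all: by end_near. Qed.

End laplace_uniqueness.

(** Continuity of the measure from above removes the gap between the two
    thresholds of [laplace_tail_le]. *)
Lemma laplace_tail_eq (d : measure_display) (T : measurableType d) (R : realType)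
    (P : probability T R) (U V : T -> R) (c : R) :
  measurable_fun setT U -> measurable_fun setT V ->
  (forall w, 0 <= U w) -> (forall w, 0 <= V w) ->
  (forall u : R, 0 <= u ->
    'E_P[(fun w => expR (- (u * U w)))%R]%E =
    'E_P[(fun w => expR (- (u * V w)))%R]%E) ->
  0 < c -> P [set w | c <= U w] = P [set w | c <= V w].
Proof.
move: U V.
suff h (U V : T -> R) : measurable_fun setT U -> measurable_fun setT V ->
    (forall w, 0 <= U w) -> (forall w, 0 <= V w) ->
    (forall u : R, 0 <= u ->
      'E_P[(fun w => expR (- (u * U w)))%R]%E =
      'E_P[(fun w => expR (- (u * V w)))%R]%E) ->
    0 < c -> (P [set w | (c <= V w)%R] <= P [set w | (c <= U w)%R])%E.
  move=> U V mU mV U0 V0 UV c0; apply/eqP; rewrite eq_le !h//.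
  by move=> u u0; rewrite UV.
move=> mU mV U0 V0 UV c0.
pose F n := [set w | c - c / n.+2%:R <= U w].
have Fc n : 0 < c - c / n.+2%:R < c.
  have : 0 < c / n.+2%:R < c.
    by rewrite divr_gt0//= ltr_pdivrMr// ltr_pMr// ltr1n.
  by move: (c / _) => z /andP[? ?]; apply/andP; split; lra.
have cF : P (F n) @[n --> \oo] --> P (\bigcap_n F n).
  apply: nonincreasing_cvg_mu.
  - by rewrite (le_lt_trans (probability_le1 _ _)) ?ltry//; exact: measurable_ge_set.
  - by move=> n; exact: measurable_ge_set.
  - by apply: bigcap_measurable => // n _; exact: measurable_ge_set.
  - move=> n m nm; apply/subsetPset => w; rewrite /F/=; apply: le_trans.
    by rewrite lerD2l lerN2 ler_pM2l// lef_pV2 ?posrE// ler_nat !ltnS.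
have <- : \bigcap_n F n = [set w | c <= U w].
  apply/seteqP; split => w /= h; last first.
    by move=> n _; rewrite /F/= (le_trans _ h)// ltW//; case/andP: (Fc n).
  apply/ler_addgt0Pr => e e0.
  pose k := Num.truncn (c / e).
  have := h k I; rewrite /F/= lerBlDr => /le_trans; apply; rewrite lerD2l.
  rewrite ler_pdivrMr// mulrC -ler_pdivrMr//.
  by apply: ltW; apply: (lt_trans (truncnS_gt _)); rewrite ltr_nat.
rewrite -(cvg_lim _ cF)//; apply: lime_ge; first exact: (cvgP _ cF).
near=> n; have /andP[? ?] := Fc n; exact: laplace_tail_le.
Unshelve. all: by end_near. Qed.

(** * First-passage times of the stable subordinator *)

Lemma measure_eq_mod_null (d : measure_display) (T : measurableType d)
    (R : realType) (P : probability T R) (A B N : set T) :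
  measurable A -> measurable B -> measurable N -> P N = 0%E ->
  A `<=` B -> B `<=` A `|` N -> P A = P B.
Proof.
move=> mA mB mN N0 AB BA; apply/eqP; rewrite eq_le le_measure ?inE//=.
apply: (@le_trans _ _ (P (A `|` N))).
  by apply: le_measure; rewrite ?inE//; exact: measurableU.
by rewrite measureU0.
Qed.

Section first_passage.
Context (d : measure_display) (Omega : measurableType d) (R : realType).
Variables (P : probability Omega R) (alpha : R) (eta : R -> Omega -> R).
Hypothesis eta_sub : stable_subordinator P alpha eta.
Local Notation T := (first_passage_time eta).

Let eta_levy := subordinator_levy eta_sub.

Lemma measurable_eta r : 0 <= r -> measurable_fun setT (eta r).
Proof. exact: levy_measurable eta_levy r. Qed.

Lemma eta0 w : eta 0 w = 0.
Proof. exact: levy_start eta_levy w. Qed.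

Lemma eta_le w (r1 r2 : R) : 0 <= r1 -> r1 <= r2 -> eta r1 w <= eta r2 w.
Proof. exact: subordinator_nondecreasing eta_sub w r1 r2. Qed.

Lemma eta_ge0 r w : 0 <= r -> 0 <= eta r w.
Proof. by move=> r0; rewrite -(eta0 w) eta_le. Qed.

Lemma measurable_eta_lt r t : 0 <= r -> measurable [set w | eta r w < t].
Proof.
move=> r0; have := measurableC (measurable_ge_set t (measurable_eta r0)).
congr (measurable _); apply/seteqP; split => w /=; first by move/negP; rewrite -ltNge.
by move=> h; apply/negP; rewrite -ltNge.
Qed.

(** Markov inequality for exp (- eta_r). *)
Lemma eta_lt_exp r t : 0 <= r -> (P [set w | (eta r w < t)%R] <= (expR (t - r))%:E)%E.
Proof.
move=> r0; have mA := measurable_eta_lt t r0.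
have := subordinator_laplace eta_sub r0 (@ler01 R).
rewrite powR1 mulr1 => h.
have : ((expR (- t))%:E * P [set w | (eta r w < t)%R] <= (expR (- r))%:E)%E.
  rewrite -expectation_scaled_indic ?expR_ge0// -h.
  apply: expectation_le.
  - by apply: measurable_funM => //; exact: measurable_indic.
  - apply: measurableT_comp; first exact: measurable_expR.
    apply: measurableT_comp => //; apply: measurable_funM => //.
    exact: measurable_eta.
  - by move=> w; rewrite /= mulr_ge0 ?expR_ge0.
  - by move=> w; rewrite expR_ge0.
  apply: aeW => w /=; rewrite indicE; case: (boolP (w \in _)) => wA.
    by rewrite mulr1 mul1r ler_expR lerN2 ltW//; move/set_mem : wA.
  by rewrite mulr0 expR_ge0.
rewrite -(fineK (fin_num_measure P _ mA)) -EFinM !lee_fin => h2.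
by rewrite expRD mulrC -ler_pdivrMr ?expR_gt0// -expRN mulrC.
Qed.

(** The exceptional event on which the set defining the first-passage time is
    empty, and its infimum is 0 by convention. *)
Definition unreached t := [set w | forall r, 0 < r -> eta r w < t].

Lemma unreachedE t : unreached t = \bigcap_n [set w | eta n.+1%:R w < t].
Proof.
apply/seteqP; split => w h; first by move=> n _; exact: h.
move=> r r0; have := h (Num.truncn r) I; apply: le_lt_trans.
by apply: eta_le; [exact: ltW|exact/ltW/truncnS_gt].
Qed.

Lemma measurable_unreached t : measurable (unreached t).
Proof.
by rewrite unreachedE; apply: bigcap_measurable => // n _; exact: measurable_eta_lt.
Qed.

Lemma unreached0 t : P (unreached t) = 0%E.
Proof.
apply/eqP; rewrite eq_le measure_ge0 andbT.
have mU := measurable_unreached t.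
have h n : fine (P (unreached t)) <= expR t * (expR (-1)) ^+ n.+1.
  rewrite -lee_fin fineK ?fin_num_measure// -expRM_natl -expRD mulrN1.
  apply: (le_trans _ (eta_lt_exp t (ler0n _ n.+1))).
  apply: le_measure; rewrite ?inE//; first exact: measurable_eta_lt.
  by rewrite unreachedE => w; apply.
rewrite -(fineK (fin_num_measure P _ mU)) lee_fin.
have l : expR t * (expR (-1)) ^+ n.+1 @[n --> \oo] --> expR t * (0 : R).
  apply: cvgM; first exact: cvg_cst.
  have : (expR (-1)) ^+ n @[n --> \oo] --> (0 : R).
    by apply: cvg_expr; rewrite ger0_norm ?expR_ge0// -[ltRHS]expR0 ltr_expR ltrN10.
  by rewrite (cvg_shiftS (fun n => (expR (-1) : R) ^+ n)).
move: l; rewrite mulr0 => l.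
by apply: (ler_cvg_to (cvg_cst (fine (P (unreached t)))) l); near=> n; exact: h.
Unshelve. all: by end_near. Qed.

Lemma fpt_ge0 t w : 0 <= T t w.
Proof.
rewrite /first_passage_time.
have [->|/set0P ne] := eqVneq [set r | 0 < r /\ t <= eta r w] set0.
  by rewrite inf0.
by apply: lb_le_inf => // r [/ltW].
Qed.

Lemma fpt_gt_eta t r w : 0 < t -> 0 <= r -> r < T t w -> eta r w < t.
Proof.
move=> t0; rewrite le_eqVlt => /predU1P[<- _|r0 rT]; first by rewrite eta0.
rewrite ltNge; apply/negP => te; move: rT; rewrite ltNge => /negP; apply.
rewrite /first_passage_time; apply: ge_inf => //.
by exists 0 => x [/ltW].
Qed.

(** Right-continuity keeps eta below [t] slightly beyond [r]. *)
Lemma eta_gt_fpt t r w : 0 < t -> 0 <= r -> ~ unreached t w ->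
  eta r w < t -> r < T t w.
Proof.
move=> t0 r0 nu rt.
have cr := @levy_right_continuous _ _ _ _ _ eta_levy w _ r0.
have : \forall x \near r^'+, eta x w < t by exact: (cvgr_lt _ cr).
move=> near_r.
have [r' [rr' r't]] : exists r', r < r' /\ eta r' w < t.
  have : \forall x \near r^'+, r < x /\ eta x w < t.
    near=> x; split; first by near: x; exact: nbhs_right_gt.
    by near: x.
  by move=> /filter_ex [x ?]; exists x.
apply: (lt_le_trans rr'); rewrite /first_passage_time; apply: lb_le_inf.
  apply: contrapT => ne; apply: nu => x x0.
  rewrite ltNge; apply/negP => tx; apply: ne; by exists x.
move=> x [x0 tx]; rewrite leNgt; apply/negP => xr'.
have := le_lt_trans (eta_le w (ltW x0) (ltW xr')) r't.
by rewrite ltNge tx.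
Unshelve. all: by end_near. Qed.

Lemma fpt0 w : T 0 w = 0.
Proof.
apply/eqP; rewrite eq_le fpt_ge0 andbT; apply/ler_addgt0Pr => e e0.
rewrite add0r; apply: ge_inf; first by exists 0 => x [/ltW].
by split => //; exact: eta_ge0 (ltW e0).
Qed.

Lemma fpt_gtE t r : 0 < t -> 0 <= r ->
  [set w | r < T t w] = [set w | eta r w < t] `\` unreached t.
Proof.
move=> t0 r0; apply/seteqP; split => w /=; last first.
  by move=> [? ?]; exact: eta_gt_fpt.
move=> rT; split; first exact: fpt_gt_eta rT.
move=> nu; move: rT; rewrite /first_passage_time (_ : [set r | _] = set0).
  by rewrite inf0 ltNge r0.
by rewrite -subset0 => x [/nu]; rewrite ltNge => /negP.
Qed.

Lemma measurable_fpt t : 0 <= t -> measurable_fun setT (T t).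
Proof.
rewrite le_eqVlt => /predU1P[<-|t0].
  by rewrite (_ : T 0 = cst 0)//; apply/funext => w; rewrite fpt0.
apply: (measurability _ (RGenOInfty.measurableE R)) => //.
move=> _ [_ [x ->] <-]; rewrite setTI.
rewrite (_ : _ @^-1` _ = [set w | x < T t w]); last first.
  by apply/seteqP; split => w /=; rewrite in_itv/= andbT.
have [x0|x0] := leP 0 x.
  rewrite fpt_gtE//; apply: measurableD; first exact: measurable_eta_lt.
  exact: measurable_unreached.
rewrite (_ : [set _ | _] = setT)//; apply/seteqP; split => w //= _.
exact: lt_le_trans (fpt_ge0 t w).
Qed.

Lemma fpt_tail t r : 0 < t -> 0 <= r ->
  P [set w | r < T t w] = P [set w | eta r w < t].
Proof.
move=> t0 r0; apply: (measure_eq_mod_null (N := unreached t)).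
- exact/measurable_gt_set/measurable_fpt/ltW.
- exact: measurable_eta_lt.
- exact: measurable_unreached.
- exact: unreached0.
- by move=> w /=; exact: fpt_gt_eta.
- move=> w /= h; have [u|nu] := pselect (unreached t w); first by right.
  by left; exact: eta_gt_fpt.
Qed.

Lemma fpt_tail2 s t r y : 0 < s -> 0 < t -> 0 <= r -> 0 <= y ->
  P ([set w | r < T s w] `&` [set w | y < T t w]) =
  P ([set w | eta r w < s] `&` [set w | eta y w < t]).
Proof.
move=> s0 t0 r0 y0.
apply: (measure_eq_mod_null (N := unreached s `|` unreached t)).
- by apply: measurableI; exact/measurable_gt_set/measurable_fpt/ltW.
- by apply: measurableI; exact: measurable_eta_lt.
- by apply: measurableU; exact: measurable_unreached.
- rewrite measureU0; [exact: unreached0|exact: measurable_unreached|exact: measurable_unreached|exact: unreached0].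
- by move=> w /= [? ?]; split; exact: fpt_gt_eta.
- move=> w /= [h1 h2]; have [u|nu] := pselect (unreached s w); first by right; left.
  have [u|nu'] := pselect (unreached t w); first by right; right.
  by left; split; exact: eta_gt_fpt.
Qed.

(** Independence and stationarity of the increments over [0, r] and
    [r, r + y]. *)
Lemma eta_two_increments r y s t : 0 <= r -> 0 <= y ->
  P ([set w | eta r w < s] `&` [set w | eta (r + y) w - eta r w < t]) =
  (P [set w | (eta r w < s)%R] * P [set w | (eta y w < t)%R])%E.
Proof.
move=> r0 y0.
pose tt (n : nat) : R := if n is n'.+1 then (if n' is 0%N then r else r + y) else 0.
pose A (n : nat) : set R := if n is 0%N then [set` `]-oo, s[] else [set` `]-oo, t[].
have tt_le : {homo tt : i j / (i <= j)%N >-> i <= j}.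
  have ry : r <= r + y by rewrite lerDl.
  by move=> [|[|i]] [|[|j]] //= _; exact: addr_ge0.
have mA i : measurable (A i) by case: i => [|i]; exact: measurable_itv.
have := levy_independent_increments eta_levy 2 (lexx 0 : 0 <= tt 0%N) tt_le mA.
rewrite (_ : \bigcap_(i in `I_2) _ =
   [set w | eta r w < s] `&` [set w | eta (r + y) w - eta r w < t]); last first.
  apply/seteqP; split => w /=.
    move=> h; split; first by have := h 0%N isT; rewrite /= in_itv/= eta0 subr0.
    by have := h 1%N isT; rewrite /= in_itv/=.
  move=> [h1 h2] [|[|//]] _; rewrite /= in_itv/= ?eta0 ?subr0//.
move=> ->; rewrite !big_ord_recl big_ord0 mule1/=; congr (_ * _)%E.
  by congr (P _); apply/seteqP; split => w /=; rewrite in_itv/= eta0 subr0.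
have -> := levy_stationary_increments eta_levy r0 (_ : r <= r + y) (mA 1%N).
  rewrite addrAC subrr add0r.
  by congr (P _); apply/seteqP; split => w /=; rewrite in_itv/=.
by rewrite lerDl.
Qed.

(** Together with [fpt_tail_supermul], the renewal property at time [r] of eta: on
    the event eta_r < s, what remains of the passage to [t] is an independent
    passage to a height between t - s and t. *)
Lemma fpt_tail_submul s t r y : 0 < s -> 0 < t -> 0 <= r -> 0 <= y ->
  (P ([set w | (r < T s w)%R] `&` [set w | (r + y < T t w)%R]) <=
   P [set w | (r < T s w)%R] * P [set w | (y < T t w)%R])%E.
Proof.
move=> s0 t0 r0 y0; have ry0 := addr_ge0 r0 y0.
rewrite fpt_tail2// !fpt_tail// -eta_two_increments//.
apply: le_measure; rewrite ?inE.
- by apply: measurableI; exact: measurable_eta_lt.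
- apply: measurableI; first exact: measurable_eta_lt.
  have := measurable_gt_set (- t) (measurable_funB (measurable_eta r0) (measurable_eta ry0)).
  by congr (measurable _); apply/seteqP; split => w /=; rewrite ltrNl opprB.
- move=> w /= [h1 h2]; split => //; apply: le_lt_trans h2.
  by rewrite lerBlDr lerDl eta_ge0.
Qed.

Lemma fpt_tail_supermul s t r y : 0 < s -> s < t -> 0 <= r -> 0 <= y ->
  (P [set w | (r < T s w)%R] * P [set w | (y < T (t - s) w)%R] <=
   P ([set w | (r < T s w)%R] `&` [set w | (y < T t w)%R]))%E.
Proof.
move=> s0 st r0 y0; have ry0 := addr_ge0 r0 y0.
have ts0 : 0 < t - s by rewrite subr_gt0.
rewrite fpt_tail2//; last exact: lt_trans st.
rewrite !fpt_tail// -eta_two_increments//.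
apply: le_measure; rewrite ?inE.
- apply: measurableI; first exact: measurable_eta_lt.
  have := measurable_gt_set (- (t - s)) (measurable_funB (measurable_eta r0) (measurable_eta ry0)).
  by congr (measurable _); apply/seteqP; split => w /=; rewrite ltrNl opprB.
- by apply: measurableI; exact: measurable_eta_lt.
- move=> w /= [h1 h2]; split => //.
  have := eta_le w y0 (_ : y <= r + y); rewrite lerDr => /(_ r0); lra.
Qed.

Lemma fpt_mono s t w : 0 <= s -> s <= t -> ~ unreached t w -> T s w <= T t w.
Proof.
move=> s0 st nu; rewrite leNgt; apply/negP => h.
have [s00|s00] := eqVneq s 0.
  by move: h; rewrite s00 fpt0 ltNge fpt_ge0.
have {}s0 : 0 < s by rewrite lt_neqAle eq_sym s00.
have := fpt_gt_eta s0 (fpt_ge0 t w) h => h1.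
have t0 := lt_le_trans s0 st.
by have := eta_gt_fpt t0 (fpt_ge0 t w) nu (lt_le_trans h1 st); rewrite ltxx.
Qed.

Lemma ae_fpt_mono s t : 0 <= s -> s <= t -> {ae P, forall w, T s w <= T t w}.
Proof.
move=> s0 st; exists (unreached t); split.
- exact: measurable_unreached.
- exact: unreached0.
- move=> w /= h; apply: contrapT => nu; apply: h; exact: fpt_mono.
Qed.

(** Both sides are tails of variables with the same Laplace transform. *)
Lemma eta_scaling x t : 0 <= x -> 0 < t ->
  P [set w | eta (x * t `^ alpha) w < t] = P [set w | eta x w < 1].
Proof.
move=> x0 t0; have xt0 : 0 <= x * t `^ alpha by rewrite mulr_ge0 ?powR_ge0.
have C r c : 0 <= r -> P [set w | eta r w < c] = (1 - P [set w | (c <= eta r w)%R])%E.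
  move=> r0; rewrite -probability_setC; last exact/measurable_ge_set/measurable_eta.
  congr (P _); apply/seteqP; split => w /=; first by move=> h; apply/negP; rewrite -ltNge.
  by move/negP; rewrite -ltNge.
rewrite !C//; congr (1 - _)%E.
rewrite -(@laplace_tail_eq _ _ _ P (fun w => t^-1 * eta (x * t `^ alpha) w) (eta x))//.
- congr (P _); apply/seteqP; split => w /=; by rewrite ler_pdivlMl// mulr1.
- by apply: measurable_funM => //; exact: measurable_eta.
- exact: measurable_eta.
- by move=> w; rewrite mulr_ge0 ?invr_ge0 ?(ltW t0)// eta_ge0.
- by move=> w; exact: eta_ge0.
- move=> u u0; rewrite (subordinator_laplace eta_sub x0 u0).
  under [X in expectation P X]funext do rewrite mulrA.
  have ut0 : 0 <= u / t by rewrite divr_ge0// ltW.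
  rewrite (subordinator_laplace eta_sub xt0 ut0).
  rewrite powRM ?invr_ge0 ?(ltW t0)//; congr (expR (- _))%:E.
  rewrite -[t^-1]powR_inv1 ?(ltW t0)// -powRrM mulN1r powRN.
  by field; rewrite gt_eqF ?powR_gt0.
Qed.

(** Markov inequality for 1 - exp (- eta_m / t), whose expectation is at most
    m t^(- alpha), on the event eta_m >= t. *)
Lemma fpt_lower_tail m t : 0 <= m -> 0 < t ->
  (P [set w | (T t w <= m)%R] <= (2 * m * t `^ (- alpha))%:E)%E.
Proof.
move=> m0 t0.
have mA : measurable [set w | t <= eta m w] by exact/measurable_ge_set/measurable_eta.
have -> : P [set w | T t w <= m] = P [set w | t <= eta m w].
  transitivity (1 - P [set w | (m < T t w)%R])%E.
    rewrite -probability_setC; last exact/measurable_gt_set/measurable_fpt/ltW.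
    congr (P _); apply/seteqP; split => w /=; first by move=> h; apply/negP; rewrite -leNgt.
    by move/negP; rewrite -leNgt.
  rewrite fpt_tail// -probability_setC; last exact: measurable_eta_lt.
  congr (P _); apply/seteqP; split => w /=; first by move/negP; rewrite -leNgt.
  by move=> h; apply/negP; rewrite -leNgt.
have e1 : (2 : R) <= expR 1 by apply: le_trans (expR_ge1Dx 1).
have mE : measurable_fun setT (fun w => expR (- (t^-1 * eta m w))).
  apply: measurableT_comp; first exact: measurable_expR.
  by apply: measurableT_comp => //; apply: measurable_funM => //; exact: measurable_eta.
have Eitv w : 0 <= expR (- (t^-1 * eta m w)) <= 1.
  rewrite expR_ge0/= -[leRHS]expR0 ler_expR oppr_le0.
  by rewrite mulr_ge0 ?invr_ge0 ?(ltW t0)// eta_ge0.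
have : ((2^-1)%:E * P [set w | (t <= eta m w)%R] <=
    'E_P[cst 1%R \- (fun w => expR (- (t^-1 * eta m w)))%R])%E.
  rewrite -expectation_scaled_indic ?invr_ge0//.
  apply: expectation_le.
  - by apply: measurable_funM => //; exact: measurable_indic.
  - exact: measurable_funB.
  - by move=> w; rewrite /= mulr_ge0 ?invr_ge0.
  - by move=> w /=; rewrite subr_ge0; case/andP: (Eitv w).
  apply: aeW => w /=; rewrite indicE; case: (boolP (w \in _)) => wA; last first.
    by rewrite mulr0 subr_ge0; case/andP: (Eitv w).
  rewrite mulr1; move/set_mem : wA => /= wA.
  have : expR (- (t^-1 * eta m w)) <= 2^-1.
    rewrite expRN lef_pV2 ?posrE ?expR_gt0//; apply: (le_trans e1).
    by rewrite ler_expR ler_pdivlMl// mulr1.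
  lra.
rewrite expectationB; last 2 first.
- exact: Lfun_cst.
- apply: (@bounded_Lfun1 _ _ _ _ _ 1) => // w; have /andP[? ?] := Eitv w.
  by rewrite ger0_norm.
rewrite expectation_cst (subordinator_laplace eta_sub m0) ?invr_ge0 ?(ltW t0)//.
rewrite -(fineK (fin_num_measure P _ mA)) -EFinM -EFinB !lee_fin.
rewrite -[t^-1]powR_inv1 ?(ltW t0)// -powRrM mulN1r.
have := expR_ge1Dx (- (m * t `^ (- alpha))).
set z := m * _; rewrite -mulrA -/z; lra.
Qed.

End first_passage.

(** * Inequalities for real powers *)

Section powR_inequalities.
Context (R : realType).
Implicit Types (x y r q p theta : R).

Lemma gt_powR x r q : 0 <= x -> 0 <= r -> 0 < q -> (r < x `^ q) = (r `^ q^-1 < x).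
Proof.
move=> x0 r0 q0; have q1 : 0 < q^-1 by rewrite invr_gt0.
have K z : 0 <= z -> (z `^ q) `^ q^-1 = z.
  by move=> z0; rewrite -powRrM mulfV ?gt_eqF// powRr1.
have K' z : 0 <= z -> (z `^ q^-1) `^ q = z.
  by move=> z0; rewrite -powRrM mulVf ?gt_eqF// powRr1.
apply/idP/idP => h.
  rewrite -(K _ x0); apply: gt0_ltr_powR => //; rewrite nnegrE ?powR_ge0//.
rewrite -(K' _ r0); apply: gt0_ltr_powR => //; rewrite nnegrE ?powR_ge0//.
Qed.

Lemma powR_ge_id v p : 0 <= v <= 1 -> 0 < p <= 1 -> v <= v `^ p.
Proof.
move=> /andP[v0 v1] /andP[p0 p1].
move: v0; rewrite le_eqVlt => /predU1P[<-|v0]; first exact: powR_ge0.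
by apply: ger1_powR => //; rewrite v0.
Qed.

Lemma powR_subadd x y p : 0 <= x -> 0 <= y -> 0 < p <= 1 ->
  (x + y) `^ p <= x `^ p + y `^ p.
Proof.
move=> x0 y0 p01; have p0 : p != 0 by case/andP : p01 => /gt_eqF ->.
have := addr_ge0 x0 y0; rewrite le_eqVlt => /predU1P[<-|xy0].
  by rewrite powR0// addr_ge0// powR_ge0.
have h z : 0 <= z -> z <= x + y -> (x + y) `^ p * (z / (x + y)) <= z `^ p.
  move=> z0 zxy; rewrite -[in leRHS](@divfK _ (x + y) _ z) ?gt_eqF//.
  rewrite powRM ?divr_ge0 ?(ltW xy0)// mulrC ler_wpM2r ?powR_ge0//.
  by apply: powR_ge_id => //; rewrite divr_ge0 ?(ltW xy0)//= ler_pdivrMr// mul1r.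
have := lerD (h x x0 _) (h y y0 _); rewrite lerDl lerDr => /(_ y0 x0).
by rewrite -mulrDr -mulrDl mulfV ?mulr1// gt_eqF.
Qed.

Lemma powR_increment_concave x y theta : 0 <= y <= x -> 0 < theta <= 1 ->
  x `^ theta <= (x - y) `^ theta + y * x `^ (theta - 1).
Proof.
move=> /andP[y0 yx] th; have th0' : 0 < theta by case/andP : th.
have th0 : theta != 0 by rewrite gt_eqF.
have := le_trans y0 yx; rewrite le_eqVlt => /predU1P[<-|x0].
  by rewrite powR0// addr_ge0 ?powR_ge0// mulr_ge0// powR_ge0.
have xy0 : 0 <= x - y by rewrite subr_ge0.
have -> : x `^ (theta - 1) = x `^ theta / x.
  by rewrite -(mulr_powRB1 (ltW x0) th0') mulrAC mulfV ?gt_eqF// mul1r.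
have : x `^ theta * ((x - y) / x) <= (x - y) `^ theta.
  rewrite -[in leRHS](@divfK _ x _ (x - y)) ?gt_eqF//.
  rewrite powRM ?divr_ge0 ?(ltW x0)// mulrC ler_wpM2r ?powR_ge0//.
  by apply: powR_ge_id => //; rewrite divr_ge0 ?(ltW x0)//= ler_pdivrMr// mul1r lerBlDr lerDl.
move=> h; rewrite -lerBlDr; apply: le_trans h.
by rewrite le_eqVlt; apply/orP; left; apply/eqP; field; rewrite gt_eqF.
Qed.

(** The tangent line of the convex function x^theta at [v]: this is Young's
    inequality for [u] and v^(theta - 1) with exponents theta and
    theta / (theta - 1). *)
Lemma powR_tangent u v theta : 0 <= u -> 0 <= v -> 1 < theta ->
  v `^ theta + theta * v `^ (theta - 1) * (u - v) <= u `^ theta.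
Proof.
move=> u0 v0 th1; have th0 : 0 < theta by rewrite (lt_trans _ th1).
have p0 : 0 < theta - 1 by rewrite subr_gt0.
have := @conjugate_powR R u (v `^ (theta - 1)) theta (theta / (theta - 1)) u0
  (powR_ge0 _ _) th0 (divr_gt0 th0 p0).
have -> : theta^-1 + (theta / (theta - 1))^-1 = 1.
  by field; rewrite !gt_eqF.
move=> /(_ erefl); rewrite -powRrM.
have -> : (theta - 1) * (theta / (theta - 1)) = theta.
  by field; rewrite gt_eqF.
have -> : v `^ theta = v * v `^ (theta - 1) by rewrite mulr_powRB1.
rewrite -(ler_pM2r th0).
have -> : (u `^ theta / theta + v * v `^ (theta - 1) / (theta / (theta - 1))) * theta
  = u `^ theta + v * v `^ (theta - 1) * (theta - 1).
  by field; rewrite !gt_eqF.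
lra.
Qed.

Lemma powR_increment_convex_le x y theta : 0 <= y <= x -> 1 < theta ->
  x `^ theta <= (x - y) `^ theta + theta * (y * x `^ (theta - 1)).
Proof.
move=> /andP[y0 yx] th1; have x0 := le_trans y0 yx.
have xy0 : 0 <= x - y by rewrite subr_ge0.
have := powR_tangent xy0 x0 th1; lra.
Qed.

(** The tangent at x - y, where (x - y)^(theta - 1) is replaced by its
    lower bound x^(theta - 1) - y^(theta - 1). *)
Lemma powR_increment_convex_ge x y theta : 0 <= y <= x -> 1 < theta <= 2 ->
  (x - y) `^ theta + theta * (y * x `^ (theta - 1)) <=
  x `^ theta + theta * y `^ theta.
Proof.
move=> /andP[y0 yx] /andP[th1 th2]; have x0 := le_trans y0 yx.
have th0 : 0 < theta by rewrite (lt_trans _ th1).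
have xy0 : 0 <= x - y by rewrite subr_ge0.
have h := powR_tangent x0 xy0 th1.
have p01 : 0 < theta - 1 <= 1 by apply/andP; split; lra.
have h2 := powR_subadd xy0 y0 p01; move: h2; rewrite subrK => h2.
have {}h2 := ler_wpM2l y0 h2; move: h2.
rewrite mulrDr mulr_powRB1// -(ler_pM2l th0) => h2; lra.
Qed.

End powR_inequalities.

(** * Moments of the inverse subordinator *)

Section expectation_order.
Context (d : measure_display) (T : measurableType d) (R : realType).
Variable P : probability T R.

Lemma expectation_affine (g h : T -> R) (c : R) :
  measurable_fun setT g -> measurable_fun setT h ->
  (forall w, 0 <= g w) -> (forall w, 0 <= h w) -> 0 <= c ->
  'E_P[(fun w => g w + c * h w)%R]%E = ('E_P[g] + c%:E * 'E_P[h])%E.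
Proof.
move=> mg mh g0 h0 c0; rewrite unlock; under eq_integral do rewrite EFinD EFinM.
rewrite ge0_integralD//=.
- rewrite ge0_integralZl//=; first exact/measurable_EFinP.
  by move=> w _; rewrite lee_fin.
- by move=> w _; rewrite lee_fin.
- exact/measurable_EFinP.
- by move=> w _; rewrite -EFinM lee_fin mulr_ge0.
- by apply/measurable_EFinP; exact: measurable_funM.
Qed.

Lemma expectation_ge0_fin_num (f : T -> R) : (forall w, 0 <= f w) ->
  ('E_P[f] < +oo)%E -> 'E_P[f]%E \is a fin_num.
Proof. by move=> f0 fy; rewrite ge0_fin_numE// expectation_ge0. Qed.

Lemma expectation_le_affine (f g h : T -> R) (c : R) :
  measurable_fun setT f -> measurable_fun setT g -> measurable_fun setT h ->
  (forall w, 0 <= f w) -> (forall w, 0 <= g w) -> (forall w, 0 <= h w) ->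
  0 <= c -> ('E_P[g] < +oo)%E -> ('E_P[h] < +oo)%E ->
  {ae P, forall w, f w <= g w + c * h w} ->
  ('E_P[f] < +oo)%E /\
  fine 'E_P[f]%E <= fine 'E_P[g]%E + c * fine 'E_P[h]%E.
Proof.
move=> mf mg mh f0 g0 h0 c0 gy hy fgh.
have gfin := expectation_ge0_fin_num g0 gy.
have hfin := expectation_ge0_fin_num h0 hy.
have le : ('E_P[f] <= 'E_P[g] + c%:E * 'E_P[h])%E.
  rewrite -expectation_affine//; apply: expectation_le => //.
    by apply: measurable_funD => //; exact: measurable_funM.
  by move=> w; rewrite addr_ge0// mulr_ge0.
have fy : ('E_P[f] < +oo)%E.
  by apply: (le_lt_trans le); rewrite -(fineK gfin) -(fineK hfin) -EFinM -EFinD ltry.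
split => //; rewrite -lee_fin EFinD EFinM !fineK//.
exact: expectation_ge0_fin_num.
Qed.

Lemma expectation_affine_le (f1 f2 g1 g2 : T -> R) (c1 c2 : R) :
  measurable_fun setT f1 -> measurable_fun setT f2 ->
  measurable_fun setT g1 -> measurable_fun setT g2 ->
  (forall w, 0 <= f1 w) -> (forall w, 0 <= f2 w) ->
  (forall w, 0 <= g1 w) -> (forall w, 0 <= g2 w) ->
  0 <= c1 -> 0 <= c2 ->
  ('E_P[f1] < +oo)%E -> ('E_P[f2] < +oo)%E ->
  ('E_P[g1] < +oo)%E -> ('E_P[g2] < +oo)%E ->
  {ae P, forall w, f1 w + c1 * f2 w <= g1 w + c2 * g2 w} ->
  fine 'E_P[f1]%E + c1 * fine 'E_P[f2]%E <=
  fine 'E_P[g1]%E + c2 * fine 'E_P[g2]%E.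
Proof.
move=> mf1 mf2 mg1 mg2 f10 f20 g10 g20 c10 c20 f1y f2y g1y g2y fg.
rewrite -lee_fin !EFinD !EFinM !fineK ?expectation_ge0_fin_num//.
rewrite -!expectation_affine//; apply: expectation_le => //.
- by apply: measurable_funD => //; exact: measurable_funM.
- by apply: measurable_funD => //; exact: measurable_funM.
- by move=> w; rewrite addr_ge0// mulr_ge0.
- by move=> w; rewrite addr_ge0// mulr_ge0.
Qed.

End expectation_order.

Section moments.
Context (d : measure_display) (Omega : measurableType d) (R : realType).
Variables (P : probability Omega R) (alpha : R) (eta : R -> Omega -> R).
Hypothesis eta_sub : stable_subordinator P alpha eta.
Local Notation T := (first_passage_time eta).
Local Notation fpt_ge0 := (fpt_ge0 eta).

Lemma measurable_fptX q t : 0 <= t -> measurable_fun setT (fun w => T t w `^ q).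
Proof.
move=> t0; apply: (measurableT_comp (measurable_powR q)).
exact: (measurable_fpt eta_sub).
Qed.

Lemma fpt_powR_tail q t z : 0 < q -> 0 <= z ->
  [set w | z < T t w `^ q] = [set w | z `^ q^-1 < T t w].
Proof. by move=> q0 z0; apply/seteqP; split => w /=; rewrite gt_powR ?fpt_ge0. Qed.

Lemma expectation_fpt_scaling q t : 0 < q -> 0 < t ->
  'E_P[fun w => (T t w `^ q)%R]%E =
  ((t `^ (alpha * q))%:E * 'E_P[fun w => (T 1 w `^ q)%R])%E.
Proof.
move=> q0 t0; have ta0 := powR_gt0 alpha t0.
rewrite powRrM -(expectation_scale P (measurable_fptX q (@ler01 R))
  (fun w => powR_ge0 _ _) (powR_ge0 _ _)).
apply: eq_tail.
- exact/measurable_fptX/ltW.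
- by move=> w; rewrite powR_ge0.
- by apply: measurable_funM => //; exact: measurable_fptX.
- by move=> w; rewrite /= mulr_ge0 ?powR_ge0.
move=> z z0; rewrite fpt_powR_tail//.
have x0 : 0 <= z `^ q^-1 / t `^ alpha by rewrite divr_ge0 ?powR_ge0.
rewrite (fpt_tail eta_sub)// ?powR_ge0//.
transitivity (P [set w | z `^ q^-1 / t `^ alpha < T 1 w]).
  rewrite (fpt_tail eta_sub)// -(eta_scaling eta_sub x0 t0).
  by rewrite divfK// gt_eqF.
congr (P _); apply/seteqP; split => w /=;
  by rewrite -powRM ?powR_ge0 ?fpt_ge0// gt_powR ?mulr_ge0 ?powR_ge0 ?fpt_ge0// ltr_pdivrMr.
Qed.

(** The exponential tail of T_t is bounded by a multiple of
    1 / (1 + z^2) through exp x >= 1 + x^4 / 24. *)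
Lemma expectation_fpt2_lty t : 0 < t -> ('E_P[fun w => (T t w `^ 2)%R] < +oo)%E.
Proof.
move=> t0; apply: (@sqr_tail_integrable _ _ _ _ _ (26 * expR t)).
- exact/measurable_fptX/ltW.
- by move=> w; rewrite powR_ge0.
move=> z z0; rewrite fpt_powR_tail// (fpt_tail eta_sub)// ?powR_ge0//.
apply: (le_trans (eta_lt_exp eta_sub t (powR_ge0 _ _))); rewrite lee_fin.
set x := z `^ _; have x0 : 0 <= x by rewrite powR_ge0.
have zE : z = x ^+ 2.
  by rewrite /x -powR_mulrn ?powR_ge0// -powRrM mulVf// powRr1.
have h : 1 + z ^+ 2 <= 26 * expR x.
  rewrite zE -exprM; have := expR_ge1Dxn 3 x0; rewrite (_ : 4`!%:R = 24)//.
  have : 1 <= expR x by rewrite -[leLHS]expR0 ler_expR.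
  by rewrite (_ : (2 * 2)%N = 4%N)//; move: (x ^+ 4) (expR x) => a b; lra.
rewrite ler_pdivlMr; last by rewrite ltr_pwDl// exprn_ge0.
rewrite expRD expRN; have := ler_wpM2l (ltW (divr_gt0 (expR_gt0 t) (expR_gt0 x))) h.
move/le_trans; apply; rewrite (_ : _ * (26 * _) = 26 * expR t)//.
by field; rewrite gt_eqF ?expR_gt0.
Qed.

Lemma expectation_fpt_lty q t : 0 < q <= 2 -> 0 <= t ->
  ('E_P[fun w => (T t w `^ q)%R] < +oo)%E.
Proof.
move=> /andP[q0 q2]; rewrite le_eqVlt => /predU1P[<-|t0].
  have -> : (fun w => T 0 w `^ q) = cst 0.
    by apply/funext => w; rewrite (fpt0 eta_sub) powR0// gt_eqF.
  by rewrite expectation_cst ltry.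
have t0' := ltW t0.
have [] := @expectation_le_affine _ _ _ P (fun w => T t w `^ q)
   (fun w => T t w `^ 2) (cst 1) 1 => //.
- exact: measurable_fptX.
- exact: measurable_fptX.
- by move=> w; rewrite powR_ge0.
- by move=> w; rewrite powR_ge0.
- exact: expectation_fpt2_lty.
- by rewrite expectation_cst ltry.
apply: aeW => w; rewrite mul1r.
have [h|h] := leP 1 (T t w).
  by apply: (le_trans (ler_powR h q2)); rewrite lerDl.
apply: ler_wpDl; first exact: powR_ge0.
rewrite /cst -[leRHS](congr1 (fun f => f q) (powR1 R)).
by apply: ge0_ler_powR; rewrite ?nnegrE ?fpt_ge0 ?ltW.
Qed.

Definition fpt_moment q t : R := fine 'E_P[fun w => (T t w `^ q)%R]%E.

Lemma fpt_momentK q t : 0 < q <= 2 -> 0 <= t ->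
  'E_P[fun w => (T t w `^ q)%R]%E = (fpt_moment q t)%:E.
Proof.
move=> q0 t0; rewrite fineK// ge0_fin_numE ?expectation_fpt_lty//.
by apply: expectation_ge0 => w; rewrite powR_ge0.
Qed.

Lemma fpt_moment_ge0 q t : 0 <= fpt_moment q t.
Proof. by apply: fine_ge0; apply: expectation_ge0 => w; rewrite powR_ge0. Qed.

Lemma fpt_momentE q t : 0 < q <= 2 -> 0 < t ->
  fpt_moment q t = t `^ (alpha * q) * fpt_moment q 1.
Proof.
move=> q02 t0; have q0 : 0 < q by case/andP : q02.
by rewrite /fpt_moment expectation_fpt_scaling// fpt_momentK// -EFinM.
Qed.

(** Since E exp (- eta_r) = exp (- r) exceeds exp (- 1) for r = 1/2, eta_(1/2)
    is below 1 with positive probability, so that T_1 > 1/2 with positive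
    probability. *)
Lemma fpt_moment1_gt0 q : 0 < q <= 2 -> 0 < fpt_moment q 1.
Proof.
move=> q02; have q0 : 0 < q by case/andP : q02.
have h0 : (0:R) <= 2^-1 by rewrite invr_ge0.
have mA : measurable [set w | eta 2^-1 w < 1] by exact: (measurable_eta_lt eta_sub).
have pA : 0 < fine (P [set w | eta 2^-1 w < 1]).
  have : (expR (- 2^-1) : R) <= expR (- 1) + 1 * fine (P [set w | eta 2^-1 w < 1]).
    have h1 := subordinator_laplace eta_sub h0 (@ler01 R).
    rewrite powR1 mulr1 in h1.
    have -> : expR (- 2^-1) = fine 'E_P[(fun w => expR (- (1 * eta 2^-1 w)))%R]%E.
      by rewrite h1.
    rewrite -[P _]expectation_indic//.
    have -> : expR (-1) = fine 'E_P[cst (expR (-1) : R)]%E by rewrite expectation_cst.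
    pose f w : R := expR (- (1 * eta 2^-1 w)).
    suff [] : ('E_P[f] < +oo)%E /\ fine 'E_P[f]%E <= fine 'E_P[cst (expR (-1) : R)]%E
      + 1 * fine 'E_P[\1_[set w | (eta 2^-1 w < 1)%R]]%E by [].
    apply: expectation_le_affine => //.
    - apply: measurableT_comp; first exact: measurable_expR.
      apply: measurableT_comp => //; apply: measurable_funM => //.
      exact: (measurable_eta eta_sub).
    - by move=> w; rewrite expR_ge0.
    - by move=> w; rewrite expR_ge0.
    - by rewrite expectation_cst ltry.
    - by rewrite expectation_indic// (le_lt_trans (probability_le1 P mA)) ?ltry.
    apply: aeW => w; rewrite !mul1r indicE; case: (boolP (w \in _)) => wA.
      apply: ler_wpDl; first exact: expR_ge0.
      by rewrite /f -[leRHS]expR0 ler_expR oppr_le0 mul1r; exact: (eta_ge0 eta_sub).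
    rewrite addr0 ler_expR lerN2 leNgt; apply/negP => h.
    by move: h; rewrite mul1r => h; move/negP : wA; apply; apply/mem_set.
  rewrite mul1r; have : expR (-1) < expR (- 2^-1) :> R.
    by rewrite ltr_expR ltrN2 invf_lt1// ltr1n.
  lra.
have mB : measurable [set w | 2^-1 < T 1 w].
  exact/measurable_gt_set/(measurable_fpt eta_sub).
have : ((2^-1 `^ q)%:E * P [set w | (2^-1 < T 1 w)%R] <= 'E_P[fun w => (T 1 w `^ q)%R])%E.
  rewrite -expectation_scaled_indic ?powR_ge0//; apply: expectation_le.
  - by apply: measurable_funM => //; exact: measurable_indic.
  - exact: measurable_fptX.
  - by move=> w; rewrite /= mulr_ge0 ?powR_ge0.
  - by move=> w; rewrite powR_ge0.
  apply: aeW => w /=; rewrite indicE; case: (boolP (w \in _)) => wA.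
    rewrite mulr1; apply: ge0_ler_powR; rewrite ?nnegrE ?fpt_ge0 ?(ltW q0)//.
    by move/set_mem : wA => /= /ltW.
  by rewrite mulr0 powR_ge0.
rewrite (fpt_tail eta_sub)// fpt_momentK// -(fineK (fin_num_measure P _ mA)).
rewrite -EFinM lee_fin; apply: lt_le_trans; rewrite mulr_gt0// powR_gt0//.
Qed.

Lemma expectation_fpt1 s : 'E_P[T s]%E = 'E_P[fun w => (T s w `^ 1)%R]%E.
Proof. by congr expectation; apply/funext => w; rewrite powRr1// fpt_ge0. Qed.

(** Lower half of the decoupling of T_s and T_t, from
    [fpt_tail_supermul]. *)
Lemma expectation_fpt_prod_ge s t p : 0 < s < t -> 0 < p <= 1 ->
  ((fpt_moment p (t - s) * fpt_moment 1 s)%:E <=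
   'E_P[T s \* (fun w => T t w `^ p)%R])%E.
Proof.
move=> /andP[s0 st] /andP[p0 p1].
have p02 : 0 < p <= 2 by rewrite p0 (le_trans p1)// ler1n.
have t0 := lt_trans s0 st; have ts0 : 0 < t - s by rewrite subr_gt0.
have mT : measurable_fun setT (T s) by exact: (measurable_fpt eta_sub (ltW s0)).
rewrite EFinM -(fpt_momentK (q := 1)) ?(ltW s0)//; last by rewrite ltr01 ler1n.
rewrite -expectation_fpt1 -expectation_scale//; last 2 first.
- by move=> w; exact: fpt_ge0.
- exact: fpt_moment_ge0.
apply: layer_cake_le => //.
- by move=> w; exact: fpt_ge0.
- by move=> w; exact: fpt_moment_ge0.
- exact/measurable_fptX/ltW.
- by move=> w; exact: fpt_ge0.
- by move=> w; exact: powR_ge0.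
move=> r r0; have mA := measurable_gt_set r mT.
rewrite expectation_scaled_indic ?fpt_moment_ge0//.
rewrite -fpt_momentK ?(ltW ts0)// -(fineK (fin_num_measure P _ mA)) muleC.
rewrite -[leRHS]mul1e; apply: tail_le => //.
- exact/measurable_fptX/ltW.
- by move=> w; exact: powR_ge0.
- by apply: measurable_funM; [exact/measurable_fptX/ltW|exact: measurable_indic].
- by move=> w; rewrite /= mulr_ge0 ?powR_ge0.
- by rewrite fine_ge0.
move=> z z0; rewrite fineK ?fin_num_measure// mul1e fpt_powR_tail//.
apply: (le_trans (fpt_tail_supermul eta_sub s0 st r0 (powR_ge0 z p^-1))).
rewrite -fpt_powR_tail//; apply: le_measure; rewrite ?inE.
- apply: measurableI => //.
  by apply: measurable_gt_set; exact/measurable_fptX/ltW.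
- apply: measurable_gt_set.
  by apply: measurable_funM; [exact/measurable_fptX/ltW|exact: measurable_indic].
- by move=> w /= [rT zT]; rewrite indicE mem_set//= mulr1.
Qed.

(** Upper half of the decoupling: on the event T_s > r, subadditivity gives
    T_t^p <= T_s^p + (T_t - r)^p, and (T_t - r)^+ has at most the tail of an
    independent copy of T_t. *)
Lemma expectation_fpt_prod_le s t p : 0 < s -> 0 < t -> 0 < p <= 1 ->
  ('E_P[T s \* (fun w => T t w `^ p)%R] <=
   (fpt_moment (1 + p) s + fpt_moment p t * fpt_moment 1 s)%:E)%E.
Proof.
move=> s0 t0 /andP[p0 p1].
have p02 : 0 < p <= 2 by rewrite p0 (le_trans p1)// ler1n.
have mT : measurable_fun setT (T s) by exact: (measurable_fpt eta_sub (ltW s0)).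
have mTt : measurable_fun setT (T t) by exact: (measurable_fpt eta_sub (ltW t0)).
have c0 := fpt_moment_ge0 p t; set c := fpt_moment p t in c0 *.
pose f w := T s w * (T s w `^ p + c).
have mf : measurable_fun setT f.
  by apply: measurable_funM => //; apply: measurable_funD => //; exact/measurable_fptX/ltW.
have f0 w : 0 <= f w by rewrite mulr_ge0 ?fpt_ge0// addr_ge0 ?powR_ge0.
have p12 : 0 < 1 + p <= 2 by apply/andP; split; lra.
have o12 : 0 < (1 : R) <= 2 by rewrite ltr01 ler1n.
have [fy fle] : ('E_P[f] < +oo)%E /\
    fine 'E_P[f]%E <= fpt_moment (1 + p) s + c * fpt_moment 1 s.
  apply: expectation_le_affine => //.
  - exact/measurable_fptX/ltW.
  - exact/measurable_fptX/ltW.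
  - by move=> w; exact: powR_ge0.
  - by move=> w; exact: powR_ge0.
  - exact/expectation_fpt_lty/ltW.
  - exact/expectation_fpt_lty/ltW.
  apply: aeW => w; rewrite powRr1 ?fpt_ge0// /f mulrDr mulrC [c * _]mulrC.
  have p1_gt0 : 0 < 1 + p by case/andP: p12.
  by rewrite -(mulr_powRB1 (fpt_ge0 s w) p1_gt0) [1 + p]addrC addrK mulrC.
apply: (@le_trans _ _ 'E_P[T s \* (fun w => (T s w `^ p + c)%R)]%E); last first.
  by rewrite -[leLHS]fineK ?lee_fin// ge0_fin_numE// expectation_ge0.
apply: layer_cake_le => //.
- exact/measurable_fptX/ltW.
- by move=> w; exact: fpt_ge0.
- by move=> w; exact: powR_ge0.
- by apply: measurable_funD => //; exact/measurable_fptX/ltW.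
- by move=> w; exact: fpt_ge0.
- by move=> w; rewrite addr_ge0// powR_ge0.
move=> r r0; have mA := measurable_gt_set r mT.
set A := [set w | _] in mA *.
have PA := fin_num_measure P _ mA.
pose h w := Num.max (T t w - r) 0 `^ p * \1_A w.
have mmax : measurable_fun setT (fun w => Num.max (T t w - r) 0).
  by apply: measurable_maxr => //; exact: measurable_funB.
have mh : measurable_fun setT h.
  apply: measurable_funM; last exact: measurable_indic.
  exact: (measurableT_comp (measurable_powR p)).
have h0 w : 0 <= h w by rewrite mulr_ge0 ?powR_ge0.
have max0 w : 0 <= Num.max (T t w - r) 0 by rewrite le_max lexx orbT.
have hA : ('E_P[h] <= P A * c%:E)%E.
  rewrite -fpt_momentK ?(ltW t0)// -(fineK PA) -[leLHS]mul1e.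
  apply: tail_le => //.
  - exact/measurable_fptX/ltW.
  - by move=> w; exact: powR_ge0.
  - by rewrite fine_ge0.
  move=> z z0; rewrite fineK// mul1e fpt_powR_tail//.
  apply: le_trans (fpt_tail_submul eta_sub s0 t0 r0 (powR_ge0 z p^-1)).
  apply: le_measure; rewrite ?inE.
  - exact: measurable_gt_set.
  - by apply: measurableI => //; exact: measurable_gt_set.
  - move=> w /=; rewrite /h indicE; case: (boolP (w \in A)) => [/set_mem wA|_]; last first.
      by rewrite mulr0 ltNge z0.
    rewrite mulr1 gt_powR// lt_max => /orP[|]; last by rewrite ltNge powR_ge0.
    by rewrite ltrBrDl => ?; split.
have mTsA : measurable_fun setT ((fun w => T s w `^ p) \* \1_A).
  by apply: measurable_funM; [exact/measurable_fptX/ltW|exact: measurable_indic].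
have TsA0 w : 0 <= T s w `^ p * \1_A w by rewrite mulr_ge0 ?powR_ge0.
have -> : 'E_P[(fun w => (T s w `^ p + c)%R) \* \1_A]%E =
    ('E_P[(fun w => (T s w `^ p)%R) \* \1_A] + P A * c%:E)%E.
  rewrite muleC -expectation_scaled_indic// unlock.
  rewrite -ge0_integralD//=.
  - by apply: eq_integral => w _; rewrite -EFinD -mulrDl.
  - by move=> w _; rewrite lee_fin.
  - exact/measurable_EFinP.
  - by move=> w _; rewrite lee_fin mulr_ge0.
  - by apply/measurable_EFinP; apply: measurable_funM => //; exact: measurable_indic.
apply: (le_trans _ (leeD2l _ hA)).
rewrite unlock -ge0_integralD//=; last 4 first.
- by move=> w _; rewrite lee_fin.
- exact/measurable_EFinP.
- by move=> w _; rewrite lee_fin.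
- exact/measurable_EFinP.
apply: ge0_le_integral => //=.
- by move=> w _; rewrite lee_fin mulr_ge0 ?powR_ge0.
- by apply/measurable_EFinP; apply: measurable_funM; [exact/measurable_fptX/ltW|exact: measurable_indic].
- by apply/measurable_EFinP; exact: measurable_funD.
move=> w _; rewrite -EFinD lee_fin /h -mulrDl indicE.
case: (boolP (w \in A)) => [/set_mem wA|_]; last by rewrite !mulr0.
rewrite !mulr1.
have rA : r `^ p <= T s w `^ p.
  by apply: ge0_ler_powR; rewrite ?nnegrE ?fpt_ge0 ?(ltW p0)//; exact: ltW.
apply: (@le_trans _ _ (r `^ p + Num.max (T t w - r) 0 `^ p)); last by rewrite lerD2r.
apply: le_trans (powR_subadd r0 (max0 w) _); last by rewrite p0.
apply: ge0_ler_powR; rewrite ?nnegrE ?fpt_ge0 ?(ltW p0) ?addr_ge0//.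
by rewrite -lerBlDl le_max lexx.
Qed.

End moments.

(** * Asymptotics of one component of the covariance *)

Lemma cvg_powR_neg (R : realType) (c : R) : c < 0 ->
  t `^ c @[t --> +oo] --> (0 : R).
Proof.
move=> c0; apply/cvgr0Pnorm_lt => e e0.
have N0 : 0 < e `^ c^-1 by exact: powR_gt0.
near=> t; have tN : e `^ c^-1 < t by near: t; exact: nbhs_pinfty_gt (num_real _).
have t0 := lt_trans N0 tN.
rewrite ger0_norm ?powR_ge0//.
have c0' : 0 < - c by rewrite oppr_gt0.
have := gt0_ltr_powR c0' (ltW N0 : _ \is Num.nneg) (ltW t0 : _ \is Num.nneg) tN.
rewrite /= -powRrM mulrN mulVf ?lt_eqF// powR_inv1 ?(ltW e0)// powRN.
by rewrite ltf_pV2 ?posrE ?powR_gt0.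
Unshelve. all: by end_near. Qed.

Lemma cvg_of_powR_bound (R : realType) (F : R -> R) (k C c : R) : c < 0 ->
  (\forall t \near +oo, k - C * t `^ c <= F t <= k + C * t `^ c) ->
  F t @[t --> +oo] --> k.
Proof.
move=> c0 h; have l := cvg_powR_neg c0.
have lC : C * t `^ c @[t --> +oo] --> C * 0 by apply: cvgM => //; exact: cvg_cst.
apply: (squeeze_cvgr h).
- by rewrite -[X in _ --> X]subr0 -[X in _ --> _ - X](mulr0 C); apply: cvgB => //; exact: cvg_cst.
- by rewrite -[X in _ --> X]addr0 -[X in _ --> _ + X](mulr0 C); apply: cvgD => //; exact: cvg_cst.
Qed.

Lemma concave_covariance_bound (R : realType) (A D S z : R) :
  D <= A -> A <= D + z -> 0 <= z -> S / 2 - z <= (A + S - D) / 2 <= S / 2 + z.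
Proof. by move=> ? ? ?; apply/andP; split; lra. Qed.

(** The arithmetic of the case theta > 1: [A], [S], [D] and [X] stand for the
    moments of T_t, of T_s, of their difference and of the product, [c] for
    E T_1^(theta - 1) E T_s, and [tp], [sp], [up] for the powers of t, s and
    t - s. *)
Lemma convex_covariance_bound (R : realType) (theta A D X S c tp sp up : R) :
  0 < theta -> 0 <= S -> 0 <= c -> 0 <= sp -> tp <= up + sp ->
  A <= D + theta * X -> D + theta * X <= A + theta * S ->
  up * c <= X -> X <= S + tp * c ->
  theta * c / 2 * tp - (theta * S + theta * c / 2 * sp + S) <= (A + S - D) / 2
    <= theta * c / 2 * tp + (theta * S + theta * c / 2 * sp + S).
Proof.
move=> th0 S0 c0 sp0 tus h1 h2 h3 h4.
have h5 := ler_wpM2l (ltW th0) h4.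
have h6 := ler_wpM2l (ltW th0) h3.
have h7 := ler_wpM2l (ltW th0) (ler_wpM2r c0 tus).
have h8 : 0 <= theta * S by rewrite mulr_ge0// ltW.
have h9 : 0 <= theta * c * sp by rewrite !mulr_ge0// ltW.
by apply/andP; split; lra.
Qed.

Section fpt_covariance_asymptotics.
Context (d : measure_display) (Omega : measurableType d) (R : realType).
Variables (P : probability Omega R) (alpha : R) (eta : R -> Omega -> R).
Hypothesis alpha_bounds : 0 < alpha < 1.
Hypothesis eta_sub : stable_subordinator P alpha eta.
Local Notation T := (first_passage_time eta).
Local Notation fpt_ge0 := (fpt_ge0 eta).
Local Notation m := (fpt_moment P eta).

Definition fpt_increment_moment theta s t : R :=
  fine 'E_P[fun w => (`|T t w - T s w| `^ theta)%R]%E.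
Local Notation D := fpt_increment_moment.

Let mT t : 0 <= t -> measurable_fun setT (T t).
Proof. exact: measurable_fpt eta_sub t. Qed.

Let mTX q t : 0 <= t -> measurable_fun setT (fun w => T t w `^ q).
Proof. exact: (measurable_fptX eta_sub). Qed.

Lemma measurable_fpt_increment theta s t : 0 <= s -> 0 <= t ->
  measurable_fun setT (fun w => `|T t w - T s w| `^ theta).
Proof.
move=> s0 t0; apply: (measurableT_comp (measurable_powR theta)).
by apply: measurableT_comp => //; apply: measurable_funB; exact: mT.
Qed.

Lemma fpt_increment_le theta s t : 0 < theta <= 2 -> 0 <= s -> s <= t ->
  ('E_P[fun w => (`|T t w - T s w| `^ theta)%R] < +oo)%E /\
  D theta s t <= m theta t.
Proof.
move=> th s0 st; have t0 := le_trans s0 st.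
have th0 : 0 < theta by case/andP : th.
have -> : m theta t = m theta t + 0 * fine 'E_P[cst (0%R : R)]%E.
  by rewrite mul0r addr0.
apply: expectation_le_affine => //.
- exact: measurable_fpt_increment.
- exact: mTX.
- by move=> w; exact: powR_ge0.
- exact: (expectation_fpt_lty eta_sub).
- by rewrite expectation_cst ltry.
apply: filterS (ae_fpt_mono eta_sub s0 st) => w stw.
rewrite mul0r addr0 ger0_norm ?subr_ge0//.
apply: ge0_ler_powR; rewrite ?nnegrE ?subr_ge0 ?fpt_ge0 ?(ltW th0)//.
by rewrite lerBlDr lerDl fpt_ge0.
Qed.

(** If T_t <= M then T_t^theta <= M^theta, and otherwise the concave increment
    is at most T_s M^(theta - 1). The choice M = t^(alpha / 2) gives both
    contributions the same negative power of [t]. *)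
Lemma fpt_increment_concave theta s t : 0 < theta < 1 -> 0 < s -> s <= t ->
  m theta t <= D theta s t + (2 + m 1 s) * t `^ (alpha * (theta - 1) / 2).
Proof.
move=> /andP[th0 th1] s0 st; have t0 := lt_le_trans s0 st.
have th2 : 0 < theta <= 2 by rewrite th0 (le_trans (ltW th1))// ler1n.
have o2 : 0 < (1 : R) <= 2 by rewrite ltr01 ler1n.
pose M := t `^ (alpha / 2); have M0 : 0 < M by exact: powR_gt0.
pose A := [set w | T t w <= M].
have mA : measurable A.
  have := measurableC (measurable_gt_set M (mT (ltW t0))).
  congr (measurable _); apply/seteqP; split => w /=; first by move/negP; rewrite -leNgt.
  by move=> h; apply/negP; rewrite -leNgt.
have mcA : measurable_fun setT (cst (M `^ theta) \* \1_A : Omega -> R).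
  by apply: measurable_funM => //; exact: measurable_indic.
have cA0 w : 0 <= (cst (M `^ theta) \* \1_A : Omega -> R) w.
  by rewrite /= mulr_ge0 ?powR_ge0.
have EcA : 'E_P[cst (M `^ theta)%R \* \1_A]%E = (M `^ theta * fine (P A))%:E.
  by rewrite expectation_scaled_indic ?powR_ge0// EFinM fineK// fin_num_measure.
pose h w := (cst (M `^ theta) \* \1_A) w + M `^ (theta - 1) * (T s w `^ 1).
have mh : measurable_fun setT h.
  by apply: measurable_funD => //; apply: measurable_funM => //; exact/mTX/ltW.
have h0 w : 0 <= h w by rewrite addr_ge0// mulr_ge0 ?powR_ge0.
have [hy hle] : ('E_P[h] < +oo)%E /\
    fine 'E_P[h]%E <= M `^ theta * fine (P A) + M `^ (theta - 1) * m 1 s.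
  rewrite [M `^ theta * fine (P A)](_ : _ = fine 'E_P[cst (M `^ theta)%R \* \1_A]%E); last by rewrite EcA.
  apply: expectation_le_affine => //.
  - exact/mTX/ltW.
  - by move=> w; exact: powR_ge0.
  - exact: powR_ge0.
  - by rewrite EcA ltry.
  - exact/(expectation_fpt_lty eta_sub)/ltW.
  - exact: aeW.
have [_] : ('E_P[fun w => (T t w `^ theta)%R] < +oo)%E /\
    m theta t <= D theta s t + 1 * fine 'E_P[h]%E.
  apply: expectation_le_affine => //.
  - exact/mTX/ltW.
  - by apply: measurable_fpt_increment; exact: ltW.
  - by move=> w; exact: powR_ge0.
  - exact: (fpt_increment_le th2 (ltW s0) st).1.
  apply: filterS (ae_fpt_mono eta_sub (ltW s0) st) => w stw.
  rewrite mul1r /h /= indicE ger0_norm ?subr_ge0//; case: (boolP (w \in A)) => wA.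
    rewrite mulr1 addrCA ler_wpDr//.
      by rewrite addr_ge0 ?mulr_ge0 ?powR_ge0.
    apply: ge0_ler_powR; rewrite ?nnegrE ?fpt_ge0 ?(ltW th0) ?(ltW M0)//.
    by move/set_mem : wA.
  have MT : M < T t w by rewrite ltNge; apply/negP => h1; move/negP : wA; apply; exact/mem_set.
  rewrite mulr0 add0r powRr1 ?fpt_ge0//.
  apply: (le_trans (@powR_increment_concave _ _ (T s w) _ _ _)).
  - by rewrite fpt_ge0 stw.
  - by rewrite th0 ltW.
  rewrite lerD2l mulrC ler_wpM2r ?fpt_ge0//.
  have -> : theta - 1 = - (1 - theta) by rewrite opprB.
  rewrite !powRN lef_pV2 ?posrE ?powR_gt0//; last exact: lt_trans MT.
  by apply: ge0_ler_powR; rewrite ?nnegrE ?fpt_ge0 ?subr_ge0 ?ltW.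
rewrite mul1r => h1; apply: (le_trans h1); rewrite lerD2l; apply: (le_trans hle).
have PA : fine (P A) <= 2 * M * t `^ (- alpha).
  by rewrite -lee_fin fineK ?fin_num_measure//; exact: (fpt_lower_tail eta_sub (ltW M0) t0).
have := ler_wpM2l (powR_ge0 M theta) PA.
have E1 : M `^ (theta - 1) = t `^ (alpha * (theta - 1) / 2).
  by rewrite /M -powRrM; congr (_ `^ _); ring.
have E2 : M `^ theta * (2 * M * t `^ (- alpha)) = 2 * t `^ (alpha * (theta - 1) / 2).
  have -> : M `^ theta * (2 * M * t `^ (- alpha)) =
      2 * (M `^ theta * M `^ 1 * t `^ (- alpha)) by rewrite powRr1 ?(ltW M0)//; ring.
  rewrite /M -!powRrM -!powRD ?(gt_eqF t0) ?implybT//.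
  by congr (_ * _ `^ _); field.
rewrite E1 E2; move: (_ / 2) => c h2.
apply: (@le_trans _ _ (2 * t `^ c + t `^ c * m 1 s)); first by rewrite lerD2r.
by rewrite [leRHS]mulrDl lerD2l mulrC.
Qed.

Lemma fpt_increment_linear s t : 0 < s -> s <= t -> D 1 s t = m 1 t - m 1 s.
Proof.
move=> s0 st; have t0 := lt_le_trans s0 st.
have o2 : 0 < (1 : R) <= 2 by rewrite ltr01 ler1n.
suff h : D 1 s t + 1 * m 1 s = m 1 t + 0 * m 1 s.
  by move: h; rewrite mul1r mul0r addr0 => <-; rewrite addrK.
apply/eqP; rewrite eq_le; apply/andP; split; apply: expectation_affine_le => //.
all: try exact/mTX/ltW.
all: try by apply: measurable_fpt_increment; exact: ltW.
all: try by move=> w; exact: powR_ge0.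
all: try exact/(expectation_fpt_lty eta_sub)/ltW.
all: try exact: (fpt_increment_le o2 (ltW s0) st).1.
all: apply: filterS (ae_fpt_mono eta_sub (ltW s0) st) => w stw;
  rewrite ger0_norm ?subr_ge0// !powRr1 ?subr_ge0 ?fpt_ge0//; lra.
Qed.

Definition fpt_product_moment p s t : R :=
  fine 'E_P[T s \* (fun w => T t w `^ p)%R]%E.

Lemma fpt_product_lty p s t : 0 < p <= 1 -> 0 < s -> 0 < t ->
  ('E_P[T s \* (fun w => T t w `^ p)%R] < +oo)%E.
Proof.
move=> p01 s0 t0; apply: (le_lt_trans (expectation_fpt_prod_le eta_sub s0 t0 p01)).
exact: ltry.
Qed.

Lemma fpt_increment_convex theta s t : 1 < theta < 2 -> 0 < s -> s <= t ->
  m theta t <= D theta s t + theta * fpt_product_moment (theta - 1) s t /\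
  D theta s t + theta * fpt_product_moment (theta - 1) s t <=
    m theta t + theta * m theta s.
Proof.
move=> /andP[th1 th2] s0 st; have t0 := lt_le_trans s0 st.
have th0 : 0 < theta by exact: lt_trans th1.
have th02 : 0 < theta <= 2 by rewrite th0 ltW.
have p01 : 0 < theta - 1 <= 1 by apply/andP; split; lra.
have mX : measurable_fun setT (T s \* (fun w => T t w `^ (theta - 1))).
  by apply: measurable_funM; [exact/mT/ltW|exact/mTX/ltW].
have X0 w : 0 <= (T s \* (fun w => T t w `^ (theta - 1))) w.
  by rewrite /= mulr_ge0 ?fpt_ge0 ?powR_ge0.
have mI := measurable_fpt_increment theta (ltW s0) (ltW t0).
have Iy := (fpt_increment_le th02 (ltW s0) st).1.
have Xy := fpt_product_lty p01 s0 t0.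
split.
  apply: (@expectation_le_affine _ _ _ P (fun w => T t w `^ theta)
    (fun w => `|T t w - T s w| `^ theta) _ theta _ _ _ _ _ _ _ _ _ _).2 => //.
  - exact/mTX/ltW.
  - by move=> w; exact: powR_ge0.
  - exact: ltW.
  apply: filterS (ae_fpt_mono eta_sub (ltW s0) st) => w stw.
  rewrite ger0_norm ?subr_ge0//; apply: powR_increment_convex_le => //.
  by rewrite fpt_ge0.
apply: expectation_affine_le => //.
all: try exact/mTX/ltW.
all: try by move=> w; exact: powR_ge0.
all: try exact/(expectation_fpt_lty eta_sub)/ltW.
all: try exact: ltW.
apply: filterS (ae_fpt_mono eta_sub (ltW s0) st) => w stw.
rewrite ger0_norm ?subr_ge0//; apply: powR_increment_convex_ge => //.
  by rewrite fpt_ge0.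
by rewrite th1 ltW.
Qed.

(** The expectation of the covariance function of a fractional Brownian motion
    of Hurst index theta / 2 at the times T_t and T_s, for s <= t. *)
Definition fpt_covariance theta s t : R := (m theta t + m theta s - D theta s t) / 2.

Definition covariance_exponent theta : R := Num.max 0 (alpha * (theta - 1)).

(** The limit is E T_s^theta / 2 if theta < 1, E T_s if theta = 1, and
    theta E T_1^(theta - 1) E T_s / 2 if theta > 1. *)
Lemma fpt_covariance_asymptotics theta s : 0 < theta < 2 -> 0 < s ->
  exists2 k : R, 0 < k &
    fpt_covariance theta s t / t `^ covariance_exponent theta @[t --> +oo] --> k.
Proof.
move=> /andP[th0 th2] s0; have /andP[a0 a1] := alpha_bounds.
have th02 : 0 < theta <= 2 by rewrite th0 ltW.
have o2 : 0 < (1 : R) <= 2 by rewrite ltr01 ler1n.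
have mpos q : 0 < q <= 2 -> 0 < m q s.
  move=> q02; rewrite (fpt_momentE eta_sub)// mulr_gt0 ?powR_gt0//.
  exact: (fpt_moment1_gt0 eta_sub).
have m_s := mpos _ th02; have m1s := mpos _ o2.
rewrite /covariance_exponent; have [th1|th1|th1] := ltgtP theta 1.
- exists (m theta s / 2); first by rewrite divr_gt0.
  have c0 : alpha * (theta - 1) / 2 < 0.
    by rewrite pmulr_llt0// pmulr_rlt0// subr_lt0.
  apply: (@cvg_of_powR_bound _ _ _ (2 + m 1 s) _ c0).
  near=> t; have st : s <= t by near: t; exact: nbhs_pinfty_ge (num_real _).
  have t0 := lt_le_trans s0 st.
  rewrite max_l; last by rewrite pmulr_rle0// subr_le0 ltW.
  rewrite powRr0 divr1 /fpt_covariance.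
  have h1 := (fpt_increment_le th02 (ltW s0) st).2.
  have h2 : m theta t <= D theta s t + (2 + m 1 s) * t `^ (alpha * (theta - 1) / 2).
    by apply: fpt_increment_concave => //; rewrite th0.
  have h3 : 0 <= (2 + m 1 s) * t `^ (alpha * (theta - 1) / 2).
    exact: mulr_ge0 (addr_ge0 (ler0n _ 2) (ltW m1s)) (powR_ge0 _ _).
  exact: concave_covariance_bound.
- pose q := theta - 1; have q01 : 0 < q <= 1 by apply/andP; split; rewrite /q; lra.
  have /andP[q0 q1] := q01; have q02 : 0 < q <= 2 by rewrite q0 (le_trans q1)// ler1n.
  pose e := alpha * q; have e0 : 0 < e by rewrite mulr_gt0.
  have e1 : 0 < e <= 1 by rewrite e0 -[leRHS]mulr1 ler_pM// ltW.
  pose mu := m q 1; have mu0 : 0 < mu by exact: (fpt_moment1_gt0 eta_sub).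
  pose k := theta * (mu * m 1 s) / 2.
  have k0 : 0 < k by rewrite !mulr_gt0// invr_gt0.
  exists k => //.
  (* collects all contributions that stay bounded in t *)
  pose C := theta * m theta s + k * s `^ e + m theta s.
  have ec : - e < 0 by rewrite oppr_lt0.
  apply: (@cvg_of_powR_bound _ _ _ C _ ec).
  near=> t; have st : s < t by near: t; exact: nbhs_pinfty_gt (num_real _).
  have t0 := lt_trans s0 st.
  rewrite max_r; last by rewrite ltW.
  rewrite -/q -/e powRN.
  have te := powR_gt0 e t0.
  have th12 : 1 < theta < 2 by rewrite th1.
  have [h1 h2] := fpt_increment_convex th12 s0 (ltW st).
  have sst : 0 < s < t by rewrite s0.
  have := expectation_fpt_prod_ge eta_sub sst q01.
  have := expectation_fpt_prod_le eta_sub s0 t0 q01.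
  rewrite -(@fineK _ 'E_P[_]%E); last first.
    apply: expectation_ge0_fin_num; last exact: fpt_product_lty.
    by move=> w; rewrite /= mulr_ge0 ?fpt_ge0 ?powR_ge0.
  rewrite !lee_fin -/(fpt_product_moment q s t).
  rewrite (_ : 1 + q = theta); last by rewrite /q addrC subrK.
  rewrite (fpt_momentE eta_sub q02 t0) (fpt_momentE eta_sub q02 (_ : 0 < t - s)) ?subr_gt0//.
  rewrite -/e -/mu => h3 h4; rewrite -!mulrA in h3 h4.
  have h5 : t `^ e <= (t - s) `^ e + s `^ e.
    have := @powR_subadd _ (t - s) s e; rewrite subrK; apply => //.
      by rewrite subr_ge0 ltW.
    exact: ltW.
  rewrite ler_pdivrMr// ler_pdivlMr// mulrBl [(k + _) * _]mulrDl divfK ?gt_eqF//.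
  apply: (convex_covariance_bound th0 (ltW m_s) _ (powR_ge0 s e) h5 h1 h2 _ h3).
    exact: mulr_ge0 (ltW mu0) (ltW m1s).
  exact: h4.
- exists (m 1 s) => //.
  have c0 : (-1 : R) < 0 by rewrite ltrN10.
  apply: (@cvg_of_powR_bound _ _ _ 0 _ c0).
  near=> t; have st : s <= t by near: t; exact: nbhs_pinfty_ge (num_real _).
  rewrite th1 subrr mulr0 maxxx powRr0 divr1 !mul0r subr0 addr0 /fpt_covariance.
  suff -> : (m 1 t + m 1 s - D 1 s t) / 2 = m 1 s by rewrite lexx.
  by rewrite fpt_increment_linear//; field.
Unshelve. all: by end_near. Qed.

End fpt_covariance_asymptotics.

(** * Averaging over an independent argument *)

Section freezing.
Context (d : measure_display) (Omega : measurableType d) (R : realType).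
Variable P : probability Omega R.
Variable G : set (set Omega).
Hypothesis mG : forall A, G A -> measurable A.
Local Notation OmG := (g_sigma_algebraType G).

Lemma g_sigma_algebra_sub (A : set Omega) : <<s G >> A -> measurable A.
Proof.
have : <<s G >> `<=` measurable.
  by apply: smallest_sub => //; exact: sigma_algebra_measurable.
exact.
Qed.

Context (dE : measure_display) (E : measurableType dE) (U : Omega -> E).
Hypothesis mU : measurable_fun setT U.
Hypothesis UG : forall A B, measurable A -> <<s G >> B ->
  P (U @^-1` A `&` B) = (P (U @^-1` A) * P B)%E.

(* the identity, read as a map to the space with fewer measurable sets *)
Let forget : Omega -> OmG := id.
Let pairing : Omega -> (E * OmG)%type := fun w => (U w, w).

Let mforget : measurable_fun setT forget.
Proof.
move=> _ A mA; rewrite setTI preimage_id; exact: g_sigma_algebra_sub.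
Qed.

Let mpairing : measurable_fun setT pairing.
Proof. exact: measurable_fun_pair. Qed.

Let Umfun : {mfun Omega >-> E} := HB.pack U (isMeasurableFun.Build _ _ _ _ _ mU).
Let forget_mfun : {mfun Omega >-> OmG} :=
  HB.pack forget (isMeasurableFun.Build _ _ _ _ _ mforget).
Let pairing_mfun : {mfun Omega >-> (E * OmG)%type} :=
  HB.pack pairing (isMeasurableFun.Build _ _ _ _ _ mpairing).

(** The law of the pair formed by [U] and the point itself, seen in the
    sigma-algebra generated by [G], is a product measure; the claim is Tonelli
    for this product. *)
Lemma freezing (f : E * OmG -> \bar R) : measurable_fun setT f ->
  (forall z, (0 <= f z)%E) ->
  (\int[P]_w f (U w, w) = \int[P]_v \int[P]_w f (U v, w))%E.
Proof.
move=> mf f0.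
transitivity (\int[distribution P pairing_mfun]_z f z)%E.
  by rewrite ge0_integral_distribution.
transitivity (\int[distribution P Umfun \x distribution P forget_mfun]_z f z)%E.
  apply: eq_measure_integral => A mA _; symmetry.
  by apply: product_measure_unique => // B C mB mC; exact: (UG mB mC).
rewrite fubini_tonelli1// ge0_integral_distribution//; last 2 first.
- exact: measurable_fun_fubini_tonelli_F.
- by move=> y; apply: integral_ge0.
apply: eq_integral => v _; rewrite /fubini_F/= ge0_integral_distribution//.
apply: (measurableT_comp mf); exact: measurable_fun_pair.
Qed.

End freezing.

Section continuous_process.
Context (d : measure_display) (Omega : measurableType d) (R : realType).
Variables (X : R -> Omega -> R) (G : set (set Omega)).
Local Notation OmG := (g_sigma_algebraType G).
Hypothesis XG : process_events X `<=` G.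
Hypothesis X_cont : forall w, {within `[0, +oo[, continuous (fun t => X t w)}.

Lemma measurable_process_events t : 0 <= t ->
  measurable_fun setT (X t : OmG -> R).
Proof.
move=> t0 _ B mB; rewrite setTI; apply: sub_sigma_algebra; apply: XG.
by exists t, B.
Qed.

Definition grid n (x : R) : R := (Num.truncn (n.+1%:R * x))%:R / n.+1%:R.

Lemma grid_ge0 n x : 0 <= grid n x.
Proof. by rewrite divr_ge0. Qed.

Lemma cvg_grid x : 0 <= x -> grid n x @[n --> \oo] --> x.
Proof.
move=> x0; apply/cvgrPdist_le => e e0.
near=> n; have n0 : (0 : R) < n.+1%:R by [].
have h := truncn_itv (mulr_ge0 (ltW n0) x0).
have [h1 h2] : grid n x <= x /\ x < grid n x + n.+1%:R^-1.
  case/andP : h => h1 h2; split.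
    by rewrite /grid ler_pdivrMr// [x * _]mulrC.
  by rewrite /grid -[X in _ + X]mul1r -mulrDl ltr_pdivlMr// [x * _]mulrC natr1.
rewrite ger0_norm ?subr_ge0//.
apply: (@le_trans _ _ n.+1%:R^-1); first by rewrite lerBlDr addrC ltW.
rewrite -[leRHS]invrK lef_pV2 ?posrE ?invr_gt0//.
apply: (@le_trans _ _ n%:R); last by rewrite ler_nat.
by near: n; exact: nbhs_infty_ger.
Unshelve. all: by end_near. Qed.

Lemma measurable_grid n : measurable_fun setT (fun z : R * OmG => X (grid n z.1) z.2).
Proof.
move=> _ B mB; rewrite setTI.
rewrite (_ : _ @^-1` B = \bigcup_k
  ([set x : R | Num.truncn (n.+1%:R * x) = k] `*`
   ((X (k%:R / n.+1%:R) : OmG -> R) @^-1` B))); last first.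
  apply/seteqP; split => -[x w] /=; first by move=> h; exists (Num.truncn (n.+1%:R * x)).
  by move=> [k _ [/= xk h]]; rewrite /grid xk.
apply: bigcupT_measurable => k; apply: measurableX; last first.
  rewrite -[X in measurable X]setTI.
  have kn : 0 <= k%:R / n.+1%:R :> R by rewrite divr_ge0.
  exact: (measurable_process_events kn).
have mt : measurable_fun setT (fun x : R => (Num.truncn (n.+1%:R * x))%:R : R).
  apply: nondecreasing_measurable => // x y xy.
  by rewrite ler_nat le_truncn// ler_pM2l.
have := mt measurableT [set k%:R] (measurable_set1 _); rewrite setTI.
congr (measurable _); apply/seteqP; split => x /=; last by move=> ->.
by move/eqP; rewrite eqr_nat => /eqP.
Qed.

(** Continuity of the paths makes the process a pointwise limit of the processes
    sampled at the grid points, which are countably many random variables.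
    Taking the maximum with 0 avoids negative times, at which nothing is
    known about the process. *)
Lemma measurable_process_pair :
  measurable_fun setT (fun z : R * OmG => X (Num.max z.1 0) z.2).
Proof.
apply: (measurable_fun_cvg (h := fun n (z : R * OmG) => X (grid n (Num.max z.1 0)) z.2)).
  move=> n; apply: (measurableT_comp (measurable_grid n)
    (g := fun z : R * OmG => (Num.max z.1 0, z.2))).
  apply: measurable_fun_pair; last exact: measurable_snd.
  by apply: measurable_maxr => //; exact: measurable_fst.
move=> [x w] _ /=; set y := Num.max x 0.
have y0 : 0 <= y by rewrite le_max lexx orbT.
have yI : (`[0, +oo[%classic : set R) y by rewrite /= in_itv/= y0.
have /subspace_continuousP/(_ y yI) Xy := @X_cont w.
apply: (cvg_comp (fun n => grid n y) _ _ Xy) => Q /= hQ.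
have h : \forall n \near \oo, (`[0, +oo[%classic : set R) (grid n y) -> Q (grid n y).
  exact: (cvg_grid y0 hQ).
suff : \forall n \near \oo, Q (grid n y) by [].
by apply: filterS h => n; apply; rewrite /= in_itv/= grid_ge0.
Qed.

End continuous_process.

(** * Second moments of the time-changed process *)

Section second_moments.
Context (d : measure_display) (Omega : measurableType d) (R : realType).
Variable P : probability Omega R.

(** Squares keep all integrands nonnegative: the shift [c] lets one formula
    record the mean and the variance. *)
Lemma sqr_integral_affine (Z : Omega -> R) (v c b : R) :
  measurable_fun setT Z -> 'E_P[Z]%E = 0%E ->
  'E_P[(fun w => Z w ^+ 2)%R]%E = v%:E ->
  (\int[P]_w (((c + b * Z w) ^+ 2)%:E) = (c ^+ 2 + b ^+ 2 * v)%:E)%E.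
Proof.
move=> mZ Z0 Zv.
have iZ2 : P.-integrable setT (fun w => (Z w ^+ 2)%:E).
  apply/integrableP; split; first by apply/measurable_EFinP; exact: measurable_funX.
  under eq_integral do rewrite gee0_abs ?lee_fin ?sqr_ge0//.
  by move: Zv; rewrite unlock => ->; rewrite ltry.
have iZ : P.-integrable setT (EFin \o Z).
  apply: (@le_integrable _ _ _ P _ measurableT _ (fun w => (1 + Z w ^+ 2)%:E)).
  - exact/measurable_EFinP.
  - move=> w _; rewrite lee_fin [leRHS]ger0_norm ?addr_ge0 ?sqr_ge0//.
    rewrite -[Z w ^+ 2]real_normK ?num_real//; have := normr_ge0 (Z w).
    move: `|_| => z z0; have := sqr_ge0 (z - 1); rewrite sqrrB1; nra.
  - under eq_fun do rewrite EFinD.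
    apply: integrableD => //.
    exact: (finite_measure_integrable_cst P 1 measurableT).
rewrite (_ : (fun w => _) =
  (fun w => (c ^+ 2)%:E + ((c * b *+ 2)%:E * (Z w)%:E + (b ^+ 2)%:E * (Z w ^+ 2)%:E))%E); last first.
  by apply/funext => w; rewrite -!EFinM -!EFinD; congr EFin; ring.
have ic : P.-integrable setT (fun=> (c ^+ 2)%:E).
  exact: (finite_measure_integrable_cst P (c ^+ 2) measurableT).
have i1 := integrableZl measurableT (c * b *+ 2) iZ.
have i2 := integrableZl measurableT (b ^+ 2) iZ2.
rewrite integralD//; last exact: integrableD.
rewrite integralD// !integralZl//.
have -> : (\int[P]_w (c ^+ 2)%:E = (c ^+ 2)%:E)%E.
  by have := expectation_cst P (c ^+ 2); rewrite unlock.
move: Z0 Zv; rewrite unlock => -> ->.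
by rewrite mule0 add0e -EFinM -EFinD.
Qed.


Lemma sqr_finite_Lfun2 (Z : Omega -> R) : measurable_fun setT Z ->
  ('E_P[(fun w => Z w ^+ 2)%R] < +oo)%E -> Z \in Lfun P 2%:E.
Proof.
move=> mZ Zy; rewrite inE/=; apply/andP; split; rewrite inE//=.
rewrite /finite_norm unlock /Lnorm; apply: poweR_lty.
move: Zy; rewrite unlock; congr (_ < _)%E; apply: eq_integral => w _.
by rewrite poweR_EFin powR_mulrn// real_normK ?num_real.
Qed.

Lemma fbm_Lfun2 (H : R) (X : R -> Omega -> R) t :
  fractional_brownian_motion P H X -> 0 <= t -> X t \in Lfun P 2%:E.
Proof.
move=> fX t0; apply: sqr_finite_Lfun2.
  exact: gaussian_process_measurable (fbm_gaussian fX) t t0.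
have := fbm_covariance fX t0 t0.
by under [X in expectation P X]funext do rewrite -expr2; move=> ->; rewrite ltry.
Qed.

Lemma fbm_increment_sqr (H : R) (X : R -> Omega -> R) x y : 0 < H ->
  fractional_brownian_motion P H X -> 0 <= x -> 0 <= y ->
  'E_P[(fun w => (X x w - X y w) ^+ 2)%R]%E = (`|x - y| `^ (2 * H))%:E.
Proof.
move=> H0 fX x0 y0.
have Xx := fbm_Lfun2 fX x0; have Xy := fbm_Lfun2 fX y0.
have Lxx := Lfun2_mul_Lfun1 Xx Xx; have Lyy := Lfun2_mul_Lfun1 Xy Xy.
have Lxy := Lfun2_mul_Lfun1 Xx Xy.
have -> : (fun w => (X x w - X y w) ^+ 2) =
    (X x \* X x \+ X y \* X y) \- 2 \o* (X x \* X y).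
  by apply/funext => w /=; ring.
rewrite expectationB ?rpredD ?Lfun_scale// expectationD// expectationZl//.
rewrite (fbm_covariance fX x0 x0) (fbm_covariance fX y0 y0) (fbm_covariance fX x0 y0).
rewrite !subrr !normr0 !powR0 ?mulf_neq0 ?gt_eqF//.
by rewrite -EFinM -[X in (X - _)%E]EFinD -EFinB; congr EFin; field.
Qed.

Lemma fbm_increment_centered (H : R) (X : R -> Omega -> R) x y :
  fractional_brownian_motion P H X -> 0 <= x -> 0 <= y ->
  'E_P[X x \- X y]%E = 0%E.
Proof.
move=> fX x0 y0.
have Pfin : P setT \is a fin_num := fin_num_measure P _ measurableT.
have Xx := Lfun_subset12 Pfin (fbm_Lfun2 fX x0).
have Xy := Lfun_subset12 Pfin (fbm_Lfun2 fX y0).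
by rewrite expectationB// (fbm_centered fX x0) (fbm_centered fX y0) sube0.
Qed.

Lemma fbm_increment_integral (H : R) (X : R -> Omega -> R) x y c b : 0 < H ->
  fractional_brownian_motion P H X -> 0 <= x -> 0 <= y ->
  (\int[P]_w ((c + b * (X x w - X y w)) ^+ 2)%:E =
   (c ^+ 2 + b ^+ 2 * `|x - y| `^ (2 * H))%:E)%E.
Proof.
move=> H0 fX x0 y0; apply: (@sqr_integral_affine (X x \- X y)).
- apply: measurable_funB; exact: gaussian_process_measurable (fbm_gaussian fX) _ _.
- exact: fbm_increment_centered fX x0 y0.
- exact: fbm_increment_sqr.
Qed.

End second_moments.

Section mixture.
Context (d : measure_display) (Omega : measurableType d) (R : realType).
Variables (P : probability Omega R) (H1 H2 a b : R) (B1 B2 : R -> Omega -> R).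
Hypothesis H1_gt0 : 0 < H1.
Hypothesis H2_gt0 : 0 < H2.
Hypothesis B1_fbm : fractional_brownian_motion P H1 B1.
Hypothesis B2_fbm : fractional_brownian_motion P H2 B2.
Hypothesis B1_B2_indep : independent_processes P B1 B2.

Lemma process_events_measurable (X : R -> Omega -> R) :
  (forall t, 0 <= t -> measurable_fun setT (X t)) ->
  process_events X `<=` measurable.
Proof.
move=> mX A [t [B [t0 mB ->]]]; rewrite -[X in measurable X]setTI; exact: mX.
Qed.

Let mB1 t : 0 <= t -> measurable_fun setT (B1 t).
Proof. exact: gaussian_process_measurable (fbm_gaussian B1_fbm) t. Qed.

Let mB2 t : 0 <= t -> measurable_fun setT (B2 t).
Proof. exact: gaussian_process_measurable (fbm_gaussian B2_fbm) t. Qed.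

(** Freezing the increment of [B1] leaves an affine function of an increment of
    [B2]. *)
Lemma mixture_increment_integral x y c : 0 <= x -> 0 <= y ->
  (\int[P]_w ((c + (a * (B1 x w - B1 y w) + b * (B2 x w - B2 y w))) ^+ 2)%:E =
   (c ^+ 2 + a ^+ 2 * `|x - y| `^ (2 * H1) + b ^+ 2 * `|x - y| `^ (2 * H2))%:E)%E.
Proof.
move=> x0 y0; pose G := process_events B2.
pose OmG := g_sigma_algebraType G.
pose U := B1 x \- B1 y.
have mU : measurable_fun setT U by apply: measurable_funB; exact: mB1.
pose f (z : R * OmG) : \bar R := ((c + (a * z.1 + b * (B2 x z.2 - B2 y z.2))) ^+ 2)%:E.
have mB2G t : 0 <= t -> measurable_fun setT (B2 t : OmG -> R).
  exact: measurable_process_events.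
have mf : measurable_fun setT f.
  apply/measurable_EFinP; apply: measurable_funX; apply: measurable_funD => //.
  apply: measurable_funD; first by apply: measurable_funM => //; exact: measurable_fst.
  apply: measurable_funM => //; apply: measurable_funB.
    exact: (measurableT_comp (mB2G x x0) measurable_snd).
  exact: (measurableT_comp (mB2G y y0) measurable_snd).
have f0 z : (0 <= f z)%E by rewrite lee_fin sqr_ge0.
have mG A : G A -> measurable A by exact: process_events_measurable.
have UG A B : measurable A -> <<s G >> B ->
    P (U @^-1` A `&` B) = (P (U @^-1` A) * P B)%E.
  move=> mA sB; apply: B1_B2_indep => //.
  have mB1G t : 0 <= t ->
      measurable_fun setT (B1 t : g_sigma_algebraType (process_events B1) -> R).
    exact: measurable_process_events.
  have := measurable_funB (mB1G x x0) (mB1G y y0).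
  by move=> /(_ measurableT A mA); rewrite setTI.
rewrite (freezing mG mU UG mf f0).
transitivity (\int[P]_v (((c + a * U v) ^+ 2)%:E + (b ^+ 2 * `|x - y| `^ (2 * H2))%:E))%E.
  apply: eq_integral => v _; rewrite -EFinD.
  rewrite -(fbm_increment_integral (c + a * U v) b H2_gt0 B2_fbm x0 y0).
  by apply: eq_integral => w _; rewrite /f/= addrA.
rewrite ge0_integralD//.
- rewrite [RHS]EFinD; congr (_ + _)%E.
    exact: (fbm_increment_integral c a H1_gt0 B1_fbm x0 y0).
  by have := expectation_cst P (b ^+ 2 * `|x - y| `^ (2 * H2)); rewrite unlock.
- by move=> w _; rewrite lee_fin sqr_ge0.
- apply/measurable_EFinP; apply: measurable_funX; apply: measurable_funD => //.
  exact: measurable_funM.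
- by move=> w _; rewrite lee_fin mulr_ge0 ?sqr_ge0 ?powR_ge0.
Qed.

Variable T : R -> Omega -> R.
Hypothesis T_ge0 : forall t w, 0 <= t -> 0 <= T t w.
Hypothesis mT : forall t, 0 <= t -> measurable_fun setT (T t).
Hypothesis T_indep : independent_of_pair P T B1 B2.
Local Notation L := (time_change (mixed_process a b B1 B2) T).

Let G := process_events B1 `|` process_events B2.
Let OmG := g_sigma_algebraType G.

Let mG A : G A -> measurable A.
Proof. by case; exact: process_events_measurable. Qed.

Let mixed_pos (z : R * OmG) : R :=
  a * B1 (Num.max z.1 0) z.2 + b * B2 (Num.max z.1 0) z.2.

Let m_mixed_pos : measurable_fun setT mixed_pos.
Proof.
apply: measurable_funD; apply: measurable_funM => //.
  apply: measurable_process_pair; last exact: fbm_continuous B1_fbm.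
  by move=> A ?; left.
apply: measurable_process_pair; last exact: fbm_continuous B2_fbm.
by move=> A ?; right.
Qed.

Let LE t w : 0 <= t -> L t w = mixed_pos (T t w, w).
Proof.
by move=> t0; rewrite /time_change /mixed_process /mixed_pos/= max_l// T_ge0.
Qed.

Lemma measurable_time_change t : 0 <= t -> measurable_fun setT (L t).
Proof.
move=> t0; apply: (eq_measurable_fun (fun w => mixed_pos (T t w, w))).
  by move=> w _; rewrite LE.
have mforget : measurable_fun setT (id : Omega -> OmG).
  by move=> _ A mA; rewrite setTI preimage_id; exact: (g_sigma_algebra_sub mG).
apply: (measurableT_comp m_mixed_pos).
exact: measurable_fun_pair (mT t0) mforget.
Qed.

(** Freezing the two random times leaves an increment of the mixture between
    deterministic times. *)
Lemma time_change_increment_integral s t c : 0 <= s -> 0 <= t ->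
  (\int[P]_w ((c + (L t w - L s w)) ^+ 2)%:E =
   \int[P]_w (c ^+ 2 + a ^+ 2 * `|T t w - T s w| `^ (2 * H1) +
              b ^+ 2 * `|T t w - T s w| `^ (2 * H2))%:E)%E.
Proof.
move=> s0 t0.
pose U w : R * R := (T t w, T s w).
have mU : measurable_fun setT U by apply: measurable_fun_pair; exact: mT.
pose f (z : (R * R) * OmG) : \bar R :=
  ((c + (mixed_pos (z.1.1, z.2) - mixed_pos (z.1.2, z.2))) ^+ 2)%:E.
have mf : measurable_fun setT f.
  apply/measurable_EFinP; apply: measurable_funX; apply: measurable_funD => //.
  apply: measurable_funB; apply: (measurableT_comp m_mixed_pos).
    apply: measurable_fun_pair; last exact: measurable_snd.
    exact: measurableT_comp measurable_fst measurable_fst.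
  apply: measurable_fun_pair; last exact: measurable_snd.
  exact: measurableT_comp measurable_snd measurable_fst.
have f0 z : (0 <= f z)%E by rewrite lee_fin sqr_ge0.
have UG A B : measurable A -> <<s G >> B ->
    P (U @^-1` A `&` B) = (P (U @^-1` A) * P B)%E.
  move=> mA sB; apply: T_indep => //.
  have mTG r : 0 <= r ->
      measurable_fun setT (T r : g_sigma_algebraType (process_events T) -> R).
    exact: measurable_process_events.
  have := measurable_fun_pair (mTG t t0) (mTG s s0).
  by move=> /(_ measurableT A mA); rewrite setTI.
transitivity (\int[P]_w f (U w, w))%E.
  by apply: eq_integral => w _; rewrite !LE.
rewrite (freezing mG mU UG mf f0); apply: eq_integral => v _.
rewrite -(mixture_increment_integral c (T_ge0 v t0) (T_ge0 v s0)).
apply: eq_integral => w _; rewrite /f /mixed_pos/= !max_l ?T_ge0//.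
by congr ((c + _) ^+ 2)%:E; ring.
Qed.

End mixture.

(** * Correlation of the time-changed process *)

Section correlation.
Context (d : measure_display) (Omega : measurableType d) (R : realType).
Variables (P : probability Omega R) (H1 H2 alpha a b : R).
Variables (B1 B2 eta : R -> Omega -> R).
Hypothesis H1_bounds : 0 < H1 < 1.
Hypothesis H2_bounds : 0 < H2 < 1.
Hypothesis B1_fbm : fractional_brownian_motion P H1 B1.
Hypothesis B2_fbm : fractional_brownian_motion P H2 B2.
Hypothesis B1_B2_indep : independent_processes P B1 B2.
Hypothesis eta_sub : stable_subordinator P alpha eta.
Variable T : R -> Omega -> R.
Hypothesis TE : forall t, 0 <= t -> T t = first_passage_time eta t.
Hypothesis T_indep : independent_of_pair P T B1 B2.
Local Notation L := (time_change (mixed_process a b B1 B2) T).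

Let H1_gt0 : 0 < H1. Proof. by case/andP : H1_bounds. Qed.
Let H2_gt0 : 0 < H2. Proof. by case/andP : H2_bounds. Qed.

Let theta12 (H : R) : 0 < H < 1 -> 0 < 2 * H <= 2.
Proof. by move=> /andP[? ?]; apply/andP; split; lra. Qed.

Let T_ge0 t w : 0 <= t -> 0 <= T t w.
Proof. by move=> t0; rewrite TE// fpt_ge0. Qed.

Let mT t : 0 <= t -> measurable_fun setT (T t).
Proof. by move=> t0; rewrite TE//; exact: (measurable_fpt eta_sub). Qed.

Let mL t : 0 <= t -> measurable_fun setT (L t).
Proof. exact: (measurable_time_change a b B1_fbm B2_fbm T_ge0 mT). Qed.

Definition mixed_increment_variance s t : R :=
  a ^+ 2 * fpt_increment_moment P eta (2 * H1) s t +
  b ^+ 2 * fpt_increment_moment P eta (2 * H2) s t.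

Definition mixed_variance t : R :=
  a ^+ 2 * fpt_moment P eta (2 * H1) t + b ^+ 2 * fpt_moment P eta (2 * H2) t.

Lemma expectation_increment_sqr s t c : 0 <= s -> s <= t ->
  'E_P[(fun w => (c + (L t w - L s w)) ^+ 2)%R]%E =
  (c ^+ 2 + mixed_increment_variance s t)%:E.
Proof.
move=> s0 st; have t0 := le_trans s0 st.
rewrite unlock (time_change_increment_integral _ _ H1_gt0 H2_gt0 B1_fbm B2_fbm
  B1_B2_indep T_ge0 mT T_indep c s0 t0).
pose I H w : R := `|first_passage_time eta t w - first_passage_time eta s w| `^ (2 * H).
have mI H : measurable_fun setT (I H) by exact: (measurable_fpt_increment eta_sub).
have I0 H w : 0 <= I H w by exact: powR_ge0.
have IK H : 0 < H < 1 -> 'E_P[I H]%E = (fpt_increment_moment P eta (2 * H) s t)%:E.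
  move=> Hb; rewrite fineK//; apply: expectation_ge0_fin_num; first exact: I0.
  exact: (fpt_increment_le eta_sub (theta12 Hb) s0 st).1.
have m1 : measurable_fun setT (fun w => c ^+ 2 + a ^+ 2 * I H1 w).
  by apply: measurable_funD => //; exact: measurable_funM.
transitivity 'E_P[(fun w => (c ^+ 2 + a ^+ 2 * I H1 w) + b ^+ 2 * I H2 w)%R]%E.
  by rewrite unlock; apply: eq_integral => w _; rewrite /I !TE.
rewrite (@expectation_affine _ _ _ P (fun w => c ^+ 2 + a ^+ 2 * I H1 w) (I H2)) ?sqr_ge0//.
  rewrite (@expectation_affine _ _ _ P (cst (c ^+ 2)) (I H1)) ?sqr_ge0//.
    by rewrite expectation_cst !IK// -!EFinM -!EFinD addrA.
  by move=> w; exact: sqr_ge0.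
by move=> w; exact: addr_ge0 (sqr_ge0 _) (mulr_ge0 (sqr_ge0 _) (I0 _ _)).
Qed.

Let L0 w : L 0 w = 0.
Proof.
rewrite /time_change TE// (fpt0 eta_sub) /mixed_process.
by rewrite (fbm_start B1_fbm) (fbm_start B2_fbm) !mulr0 addr0.
Qed.

Let increment0 H t : fpt_increment_moment P eta (2 * H) 0 t = fpt_moment P eta (2 * H) t.
Proof.
rewrite /fpt_increment_moment /fpt_moment; congr (fine (expectation P _)).
by apply/funext => w; rewrite (fpt0 eta_sub) subr0 ger0_norm// fpt_ge0.
Qed.

(** The case s = 0, where both the time and the process vanish. *)
Lemma expectation_shift_sqr t c : 0 <= t ->
  'E_P[(fun w => (c + L t w) ^+ 2)%R]%E = (c ^+ 2 + mixed_variance t)%:E.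
Proof.
move=> t0; have := expectation_increment_sqr c (lexx 0) t0.
rewrite /mixed_increment_variance !increment0 => <-.
by congr expectation; apply/funext => w; rewrite L0 subr0.
Qed.

Lemma expectation_sqr t : 0 <= t ->
  'E_P[(fun w => L t w ^+ 2)%R]%E = (mixed_variance t)%:E.
Proof.
move=> t0; have := expectation_shift_sqr 0 t0; rewrite expr0n add0r => <-.
by congr expectation; apply/funext => w; rewrite add0r.
Qed.

Lemma time_change_Lfun2 t : 0 <= t -> L t \in Lfun P 2%:E.
Proof.
move=> t0; apply: sqr_finite_Lfun2; first exact: mL.
by rewrite expectation_sqr// ltry.
Qed.

Let Pfin : P setT \is a fin_num. Proof. exact: fin_num_measure. Qed.

(** Compare the shifts by 0 and by 1 in [expectation_shift_sqr]. *)
Lemma time_change_centered t : 0 <= t -> 'E_P[L t]%E = 0%E.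
Proof.
move=> t0; have L2 := time_change_Lfun2 t0; have L1 := Lfun_subset12 Pfin L2.
have LL := Lfun2_mul_Lfun1 L2 L2.
have := expectation_shift_sqr 1 t0.
rewrite (_ : (fun w => _) = cst 1 \+ (2 \o* L t \+ L t \* L t)); last first.
  by apply/funext => w /=; ring.
rewrite expectationD ?rpredD ?Lfun_scale ?Lfun_cst//.
rewrite expectationD ?Lfun_scale// expectationZl// expectation_cst.
have -> : 'E_P[L t \* L t]%E = (mixed_variance t)%:E by rewrite -expectation_sqr.
rewrite -(fineK (expectation_fin_num L1)) -EFinM -!EFinD => -[].
by rewrite expr1n => h; congr EFin; lra.
Qed.

Lemma time_change_variance t : 0 <= t -> variance P (L t) = (mixed_variance t)%:E.
Proof.
move=> t0; rewrite varianceE; last exact: time_change_Lfun2.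
by rewrite time_change_centered// expe2 mule0 sube0 -expectation_sqr.
Qed.

Definition mixed_covariance s t : R :=
  a ^+ 2 * fpt_covariance P eta (2 * H1) s t + b ^+ 2 * fpt_covariance P eta (2 * H2) s t.

(** Polarization: twice the covariance is the sum of the two variances minus the
    variance of the increment. *)
Lemma time_change_covariance s t : 0 <= s -> s <= t ->
  covariance P (L t) (L s) = (mixed_covariance s t)%:E.
Proof.
move=> s0 st; have t0 := le_trans s0 st.
have Lt := time_change_Lfun2 t0; have Ls := time_change_Lfun2 s0.
have Lt1 := Lfun_subset12 Pfin Lt; have Ls1 := Lfun_subset12 Pfin Ls.
have LL := Lfun2_mul_Lfun1 Lt Ls.
have := varianceB Lt Ls; rewrite varianceE ?rpredB ?lee1n//.
rewrite expectationB// !time_change_centered// sube0 expe2 mule0 sube0.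
rewrite !time_change_variance//.
have -> : 'E_P[(L t \- L s) ^+ 2]%E = (mixed_increment_variance s t)%:E.
  have := expectation_increment_sqr 0 s0 st; rewrite expr0n add0r => <-.
  by congr expectation; apply/funext => w; rewrite add0r.
rewrite -(fineK (covariance_fin_num Lt1 Ls1 LL)) -EFinM -[X in (X - _)%E]EFinD -EFinB => -[] h.
congr EFin; move: h; rewrite /mixed_covariance /fpt_covariance /mixed_variance /mixed_increment_variance.
move: (fpt_moment _ _ _ _) (fpt_moment _ _ _ _) => m1 m2.
move: (fpt_moment _ _ _ _) (fpt_moment _ _ _ _) => m3 m4.
move: (fpt_increment_moment _ _ _ _ _) (fpt_increment_moment _ _ _ _ _) => d1 d2.
by move: (fine _) => c h; lra.
Qed.

Lemma CorrE s t : 0 <= s -> s <= t ->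
  Corr P (L t) (L s) =
  mixed_covariance s t / Num.sqrt (mixed_variance t * mixed_variance s).
Proof.
move=> s0 st; have t0 := le_trans s0 st.
by rewrite /Corr time_change_covariance// !expectation_sqr.
Qed.

Hypothesis alpha_bounds : 0 < alpha < 1.
Hypothesis ab_neq0 : (a, b) != (0, 0).
Hypothesis H1_lt_H2 : H1 < H2.

Let e H := covariance_exponent alpha (2 * H).

(** The component with the larger index dominates both the variance and the
    covariance, unless its coefficient is 0. Even when the two covariance
    exponents coincide the limits add up without cancellation, being
    positive. *)
Lemma dominant_index : exists H, [/\ 0 < H < 1,
  exists2 v : R, 0 < v &
    mixed_variance t / t `^ (alpha * (2 * H)) @[t --> +oo] --> v &
  forall s, 0 < s -> exists2 k : R, 0 < k &
    mixed_covariance s t / t `^ e H @[t --> +oo] --> k].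
Proof.
have /andP[a0 a1] := alpha_bounds.
have th (H : R) : 0 < H < 1 -> 0 < 2 * H < 2 by move=> /andP[? ?]; apply/andP; split; lra.
have var H t : 0 < H < 1 -> 0 < t ->
    fpt_moment P eta (2 * H) t / t `^ (alpha * (2 * H)) = fpt_moment P eta (2 * H) 1.
  move=> Hb t0; rewrite (fpt_momentE eta_sub (theta12 Hb) t0) mulrAC mulfV ?mul1r//.
  by rewrite gt_eqF ?powR_gt0.
have m1_gt0 H : 0 < H < 1 -> 0 < fpt_moment P eta (2 * H) 1.
  by move=> Hb; exact: (fpt_moment1_gt0 eta_sub (theta12 Hb)).
have [b0|b0] := eqVneq b 0.
  have a_neq0 : a != 0.
    by apply: contra_neq ab_neq0 => ->; rewrite b0.
  have a2 : 0 < a ^+ 2 by rewrite exprn_even_gt0.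
  exists H1; split => //.
    exists (a ^+ 2 * fpt_moment P eta (2 * H1) 1).
      by rewrite mulr_gt0// m1_gt0.
    apply: cvg_near_cst; near=> t.
    rewrite /mixed_variance b0 expr0n mul0r addr0 -mulrA var//.
  move=> s s0; have [k k0 kc] := fpt_covariance_asymptotics alpha_bounds eta_sub (th _ H1_bounds) s0.
  exists (a ^+ 2 * k); first by rewrite mulr_gt0.
  have -> : (fun t => mixed_covariance s t / t `^ e H1) =
      (fun t => a ^+ 2 * (fpt_covariance P eta (2 * H1) s t / t `^ e H1)).
    by apply/funext => t; rewrite /mixed_covariance b0 expr0n mul0r addr0 mulrA.
  by apply: cvgM => //; exact: cvg_cst.
have b2 : 0 < b ^+ 2 by rewrite exprn_even_gt0.
exists H2; split => //.
  exists (b ^+ 2 * fpt_moment P eta (2 * H2) 1); first by rewrite mulr_gt0// m1_gt0.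
  have c0 : alpha * (2 * H1) - alpha * (2 * H2) < 0.
    by rewrite -mulrBr pmulr_rlt0// -mulrBr pmulr_rlt0// subr_lt0.
  have lim : a ^+ 2 * fpt_moment P eta (2 * H1) 1 *
      t `^ (alpha * (2 * H1) - alpha * (2 * H2)) +
      b ^+ 2 * fpt_moment P eta (2 * H2) 1 @[t --> +oo] -->
      a ^+ 2 * fpt_moment P eta (2 * H1) 1 * 0 +
      b ^+ 2 * fpt_moment P eta (2 * H2) 1.
    apply: cvgD; last exact: cvg_cst.
    by apply: cvgM; [exact: cvg_cst|exact: cvg_powR_neg].
  move: lim; rewrite mulr0 add0r; apply: cvg_trans.
  apply: near_eq_cvg; near=> t.
  have t0 : 0 < t by near: t; exact: nbhs_pinfty_gt (num_real _).
  rewrite /mixed_variance [RHS]mulrDl -(mulrA (b ^+ 2)) var//; congr (_ + _).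
  rewrite (fpt_momentE eta_sub (theta12 H1_bounds) t0) powRB ?(gt_eqF t0) ?implybT//.
  by ring.
move=> s s0.
have [k1 k10 kc1] := fpt_covariance_asymptotics alpha_bounds eta_sub (th _ H1_bounds) s0.
have [k2 k20 kc2] := fpt_covariance_asymptotics alpha_bounds eta_sub (th _ H2_bounds) s0.
have e12 : e H1 <= e H2.
  rewrite /e /covariance_exponent le_max2//; rewrite ?lexx//.
  by rewrite ler_pM2l// lerD2r ler_pM2l// ltW.
have [k3 k30 kc3] : exists2 k3 : R, 0 <= k3 & t `^ (e H1 - e H2) @[t --> +oo] --> k3.
  move: e12; rewrite le_eqVlt => /predU1P[->|e12].
    by exists 1 => //; rewrite subrr; under eq_fun do rewrite powRr0; exact: cvg_cst.
  by exists 0 => //; apply: cvg_powR_neg; rewrite subr_lt0.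
exists (a ^+ 2 * (k1 * k3) + b ^+ 2 * k2).
  exact: ltr_wpDl (mulr_ge0 (sqr_ge0 a) (mulr_ge0 (ltW k10) k30)) (mulr_gt0 b2 k20).
apply: (@cvg_trans _ (a ^+ 2 * (fpt_covariance P eta (2 * H1) s t / t `^ e H1 * t `^ (e H1 - e H2)) +
    b ^+ 2 * (fpt_covariance P eta (2 * H2) s t / t `^ e H2) @[t --> +oo])).
  apply: near_eq_cvg; near=> t.
  have t0 : 0 < t by near: t; exact: nbhs_pinfty_gt (num_real _).
  rewrite /mixed_covariance mulrDl powRB ?(gt_eqF t0) ?implybT//.
  by field; rewrite !gt_eqF ?powR_gt0.
by apply: cvgD; apply: cvgM => //; [exact: cvg_cst|exact: cvgM|exact: cvg_cst].
Unshelve. all: by end_near. Qed.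

Lemma mixed_variance_gt0 s : 0 < s -> 0 < mixed_variance s.
Proof.
move=> s0.
have m_gt0 H : 0 < H < 1 -> 0 < fpt_moment P eta (2 * H) s.
  move=> Hb; rewrite (fpt_momentE eta_sub (theta12 Hb) s0) mulr_gt0 ?powR_gt0//.
  exact: (fpt_moment1_gt0 eta_sub (theta12 Hb)).
rewrite /mixed_variance; have [a0|a0] := eqVneq a 0.
  have b0 : b != 0 by apply: contra_neq ab_neq0 => ->; rewrite a0.
  have b2 : 0 < b ^+ 2 by rewrite exprn_even_gt0.
  exact: ltr_wpDl (mulr_ge0 (sqr_ge0 a) (fpt_moment_ge0 _ _ _ _))
    (mulr_gt0 b2 (m_gt0 _ H2_bounds)).
have a2 : 0 < a ^+ 2 by rewrite exprn_even_gt0.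
exact: ltr_pwDl (mulr_gt0 a2 (m_gt0 _ H1_bounds))
  (mulr_ge0 (sqr_ge0 b) (fpt_moment_ge0 _ _ _ _)).
Qed.

Theorem time_change_long_range_dependence : long_range_dependence P L.
Proof.
split.
  by move=> t t0; split; [exact: time_change_Lfun2|exact: time_change_centered].
have /andP[a0 a1] := alpha_bounds.
have [H [/andP[h0 h1] [v v0 var] cov]] := dominant_index.
exists (alpha * H - e H).
  rewrite /e /covariance_exponent.
  have aH : 0 < alpha * H by rewrite mulr_gt0.
  have aH1 : 0 < alpha * (1 - H) by rewrite mulr_gt0// subr_gt0.
  have [_|_] := leP 0 (alpha * (2 * H - 1)); apply/andP; split; lra.
move=> s s0; have [k k0 kc] := cov s s0; have vs := mixed_variance_gt0 s0.
pose c := k / Num.sqrt (v * mixed_variance s).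
have c0 : 0 < c by rewrite divr_gt0// sqrtr_gt0 mulr_gt0.
exists c; first by rewrite gt_eqF.
rewrite /equivalent_at_infinity.
pose F t := mixed_covariance s t / t `^ e H *
  (Num.sqrt (mixed_variance t / t `^ (alpha * (2 * H)) * mixed_variance s))^-1 / c.
apply: (@cvg_trans _ (F t @[t --> +oo])).
  apply: near_eq_cvg; near=> t.
  have st : s <= t by near: t; exact: nbhs_pinfty_ge (num_real _).
  have t0 := lt_le_trans s0 st; have vt := mixed_variance_gt0 t0.
  rewrite CorrE ?(ltW s0)// /F.
  have -> : mixed_variance t / t `^ (alpha * (2 * H)) * mixed_variance s =
      (mixed_variance t * mixed_variance s) / (t `^ (alpha * H)) ^+ 2.
    rewrite mulrAC -powR_mulrn ?powR_ge0// -powRrM; congr (_ / _ `^ _); ring.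
  rewrite sqrtrM; last exact: mulr_ge0 (ltW vt) (ltW vs).
  rewrite sqrtrV ?exprn_ge0 ?powR_ge0// sqrtr_sqr ger0_norm ?powR_ge0//.
  rewrite opprB powRB ?(gt_eqF t0) ?implybT//.
  have q0 : 0 < Num.sqrt (mixed_variance t * mixed_variance s).
    by rewrite sqrtr_gt0 mulr_gt0.
  by field; rewrite !gt_eqF ?powR_gt0.
have -> : 1 = k * (Num.sqrt (v * mixed_variance s))^-1 / c.
  by rewrite -/c mulfV// gt_eqF.
apply: cvgM; last exact: cvg_cst.
apply: cvgM => //; apply: cvgV; first by rewrite gt_eqF// sqrtr_gt0 mulr_gt0.
apply: (cvg_comp (fun t => mixed_variance t / t `^ (alpha * (2 * H)) * mixed_variance s)
  Num.sqrt _ (@sqrt_continuous R _)).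
by apply: cvgM => //; exact: cvg_cst.
Unshelve. all: by end_near. Qed.

End correlation.

Unset Implicit Arguments.

Theorem theorem2p8 (R : realType) (d : measure_display)
    (Omega : measurableType d) (P : probability Omega R)
    (H1 H2 alpha a b : R) (B1 B2 T : R -> Omega -> R)
    (H1_bounds : 0 < H1 < 1) (H2_bounds : 0 < H2 < 1)
    (alpha_bounds : 0 < alpha < 1)
    (ab_neq0 : (a, b) != (0, 0))
    (B1_fbm : fractional_brownian_motion P H1 B1)
    (B2_fbm : fractional_brownian_motion P H2 B2)
    (B1_B2_indep : independent_processes P B1 B2)
    (T_inverse : inverse_stable_subordinator P alpha T)
    (T_indep : independent_of_pair P T B1 B2)
    (H1_lt_H2 : H1 < H2)
    (exponent_bounds : 0 < 2 * alpha * H1 - alpha * H2 < 1) :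
  long_range_dependence P (time_change (mixed_process a b B1 B2) T).
Proof.
case: T_inverse => eta eta_sub TE.
exact: (time_change_long_range_dependence H1_bounds H2_bounds B1_fbm B2_fbm
  B1_B2_indep eta_sub TE T_indep alpha_bounds ab_neq0 H1_lt_H2).
Qed.
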